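(* The map $\widehat F:\widehat{\mathcal W}_0\to\widehat{\mathcal M}$ is continuous, where $\widehat{\mathcal W}_0$ carries the metric $\delta_\Box$ and $\widehat{\mathcal M}$ carries the vague topology. In particular, if $\delta_\Box(W_n,W)\to0$ with $W_n,W\in\mathcal W_0$, then $\widehat F(\widehat W_n)\to\widehat F(\widehat W)$ vaguely.
   Context: $\mathcal W_0$ is the set of symmetric measurable $W:[0,1]^2\to[0,1]$; $\mathcal H=L^2([0,1])$; $K_Wf(x)=\int_0^1W(x,y)f(y)\,dy$. For $\lambda\in\mathbb R$, $P_W(\{\lambda\})$ is the orthogonal projection onto $\ker(K_W-\lambda I)$ and $P_W(A)=\sum_{\lambda\in\sigma(K_W)\cap A}P_W(\{\lambda\})$ (strong sum) for Borel $A\subseteq\mathbb R$; $\mathcal M=\{P_W:W\in\mathcal W_0\}$. Cut norm $\|U\|_\Box=\sup_{f,g}|\int f(x)U(x,y)g(y)\,dxdy|$ over measurable $f,g:[0,1]\to[-1,1]$; $S$ = measure-preserving bijections of $[0,1]$; $U^\phi(x,y)=U(\phi(x),\phi(y))$; $\delta_\Box(U,V)=\inf_{\phi\in S}\|U-V^\phi\|_\Box$. $\widehat{\mathcal W}_0=\mathcal W_0/\{\delta_\Box=0\}$; on $\mathcal M$, $P_W\cong P_V$ iff $\delta_\Box(W,V)=0$, and $\widehat{\mathcal M}=\mathcal M/\cong$; $\widehat F(\widehat W)=\widehat{P_W}$. Vague topology on $\widehat{\mathcal M}$: induced by the convergence of nets $\widehat P_\gamma\to\widehat P$ defined by: there exist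 $W_\gamma\in\mathcal W_0$ with $P_{W_\gamma}$ representing $\widehat P_\gamma$, $\phi_\gamma\in S$, a representative $P$ of $\widehat P$ and a dense $D\subseteq\mathbb R$ with $P_{W_\gamma^{\phi_\gamma}}((a,b])\to P((a,b])$ in operator norm for all $a,b\in D$. *)

(* Defs.v *)
From HB Require Import structures.
From mathcomp Require Import all_boot all_order all_algebra.
From mathcomp Require Import all_classical all_reals all_analysis.
Set Implicit Arguments. Unset Strict Implicit. Unset Printing Implicit Defensive.
Import Order.TTheory GRing.Theory Num.Theory.
Import numFieldNormedType.Exports.
Local Open Scope classical_set_scope.
Local Open Scope ring_scope.

Section Graphons.
Variable R : realType.

Local Notation leb := (@lebesgue_measure R).

Definition I01 : set R := `[0%R, 1%R]%classic.

Definition int01 (f : R -> R) : R := Rintegral leb I01 f.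

(* W_0 : symmetric measurable W : [0,1]^2 -> [0,1]
   (functions R -> R -> R, only values on [0,1]^2 matter) *)
Definition graphon (W : R -> R -> R) : Prop :=
  measurable_fun [set: R * R] (fun p : R * R => W p.1 p.2) /\
  (forall x y, I01 x -> I01 y -> W x y = W y x) /\
  (forall x y, I01 x -> I01 y -> 0 <= W x y <= 1).

(* elements of H = L^2([0,1]) (as functions, up to a.e. equality) *)
Definition L2 (f : R -> R) : Prop :=
  measurable_fun I01 f /\ leb.-integrable I01 (fun x => ((f x) ^+ 2)%:E).

Definition ip (f g : R -> R) : R := int01 (fun x => f x * g x).
Definition norm2 (f : R -> R) : R := Num.sqrt (ip f f).

Definition K (W : R -> R -> R) (f : R -> R) : R -> R :=
  fun x => int01 (fun y => W x y * f y).

Definition eigsp (W : R -> R -> R) (l : R) : set (R -> R) :=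
  [set h | L2 h /\ norm2 (fun x => K W h x - l * h x) = 0].

Definition projto (V : set (R -> R)) (f g : R -> R) : Prop :=
  V g /\ (forall h, V h -> ip (fun x => f x - g x) h = 0).

(* g = P_W(A) f, where P_W(A) = sum_{lambda in sigma(K_W) cap A} P_W({lambda})
   as an (unordered) strong sum: the finite partial sums sum_{lambda in S} P_W({lambda}) f
   converge in L^2 to g along the net of finite subsets S of A.
   (Terms with lambda not an eigenvalue are 0, so summing over A or over
   sigma(K_W) cap A is the same; the eigenspace of 0 is ker K_W.) *)
Definition PW (W : R -> R -> R) (A : set R) (f g : R -> R) : Prop :=
  L2 g /\
  forall eps : R, 0 < eps ->
    exists S0 : seq R, (forall l, l \in S0 -> A l) /\
      forall S : seq R, uniq S -> (forall l, l \in S -> A l) ->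
        {subset S0 <= S} ->
        forall p : R -> R -> R,
          (forall l, l \in S -> projto (eigsp W l) f (p l)) ->
          norm2 (fun x => g x - \sum_(l <- S) p l x) < eps.

Definition mpb (phi : R -> R) : Prop :=
  exists psi : R -> R,
    (forall x, I01 x -> I01 (phi x)) /\ (forall x, I01 x -> I01 (psi x)) /\
    (forall x, I01 x -> psi (phi x) = x) /\ (forall x, I01 x -> phi (psi x) = x) /\
    measurable_fun I01 phi /\ measurable_fun I01 psi /\
    (forall B, measurable B -> B `<=` I01 -> leb (I01 `&` phi @^-1` B) = leb B) /\
    (forall B, measurable B -> B `<=` I01 -> leb (I01 `&` psi @^-1` B) = leb B).

Definition compose (V : R -> R -> R) (phi : R -> R) : R -> R -> R :=
  fun x y => V (phi x) (phi y).

Definition cutnorm (U : R -> R -> R) : R :=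
  sup [set r | exists f g : R -> R,
        measurable_fun I01 f /\ measurable_fun I01 g /\
        (forall x, I01 x -> -1 <= f x <= 1) /\ (forall x, I01 x -> -1 <= g x <= 1) /\
        r = `| int01 (fun x => int01 (fun y => f x * U x y * g y)) | ].

Definition delta (U V : R -> R -> R) : R :=
  inf [set r | exists phi, mpb phi /\
        r = cutnorm (fun x y => U x y - compose V phi x y)].

Definition directed (I : Type) (le : I -> I -> Prop) : Prop :=
  (exists i : I, True) /\ (forall i, le i i) /\
  (forall i j k, le i j -> le j k -> le i k) /\
  (forall i j, exists k, le i k /\ le j k).

Definition eventually (I : Type) (le : I -> I -> Prop) (P : I -> Prop) : Prop :=
  exists i0, forall i, le i0 i -> P i.

(* Vague convergence of the net (hat P_{Wn i})_i to hat P_W in hat M.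
   A representative of hat P_{Wn i} is P_V with V in W_0, delta(V, Wn i) = 0. *)
Definition vague_conv (I : Type) (le : I -> I -> Prop)
    (Wn : I -> R -> R -> R) (W : R -> R -> R) : Prop :=
  exists (Wg : I -> R -> R -> R) (phi : I -> R -> R) (W' : R -> R -> R) (D : set R),
    (forall i, graphon (Wg i) /\ delta (Wg i) (Wn i) = 0) /\
    (forall i, mpb (phi i)) /\
    graphon W' /\ delta W' W = 0 /\
    (forall x y : R, x < y -> exists d, D d /\ x < d < y) /\
    forall a b, D a -> D b ->
      forall eps : R, 0 < eps ->
        eventually le (fun i =>
          forall f g1 g2, L2 f -> norm2 f <= 1 ->
            PW (compose (Wg i) (phi i)) `]a, b]%classic f g1 ->
            PW W' `]a, b]%classic f g2 ->
            norm2 (fun x => g1 x - g2 x) <= eps).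

(* Subsets of hat M are represented by predicates U on W_0 that are invariant
   under delta = 0 (P_W ~= P_V iff delta(W,V) = 0). *)
Definition saturated (U : (R -> R -> R) -> Prop) : Prop :=
  forall V W, graphon V -> graphon W -> delta V W = 0 -> U V -> U W.

(* open sets of the vague topology: the topology induced by vague convergence
   of nets (every net converging to a point of U is eventually in U) *)
Definition vague_open (U : (R -> R -> R) -> Prop) : Prop :=
  forall (I : Type) (le : I -> I -> Prop) (Wn : I -> R -> R -> R) (W : R -> R -> R),
    directed le -> (forall i, graphon (Wn i)) -> graphon W -> U W ->
    vague_conv le Wn W -> eventually le (fun i => U (Wn i)).

End Graphons.

(* Main.v *)
Require Import Defs.
From HB Require Import structures.
From mathcomp Require Import all_boot all_order all_algebra.
From mathcomp Require Import all_classical all_reals all_analysis.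
From mathcomp Require Import measurable_realfun ring lra.
Set Implicit Arguments.
Unset Strict Implicit.
Unset Printing Implicit Defensive.
Import Order.TTheory GRing.Theory Num.Theory.
Import numFieldNormedType.Exports.
Local Open Scope classical_set_scope.
Local Open Scope ring_scope.

(* After aligning W_n with W by a measure-preserving bijection, the cut norm
   bounds the squared operator norm of K_{W_n} - K_W, up to a truncation of the
   test function. By the spectral theorem the points a, b that are not
   eigenvalues of K_W are dense, and for a nonzero such point K_W - a is bounded
   below; so the spectra of K_W and K_{W_n} both leave a gap around a and b.
   A Davis-Kahan estimate then makes the range of P_{W_n}(]a, b]) almost
   orthogonal to that of P_W(R \ ]a, b]), and conversely, which bounds
   P_{W_n}(]a, b]) - P_W(]a, b]) in operator norm. *)

(** Square-integrable functions are not identified up to null sets, so the inner product is only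
    semidefinite: equations between vectors hold up to a null vector, and conclusions are phrased
    through [N] or through inner products. Spans of eigenvectors consist of finite sums and are not
    closed, and []a, b]] may contain 0 and with it infinitely many eigenvalues; estimates are
    therefore made on finite sums and carried to the closure through [adherent]. The points a and b
    must avoid 0 because a compact operator on an infinite-dimensional space is not bounded below
    there, even when 0 is no eigenvalue. The truncation arises because the cut norm tests only
    bounded functions, while the operator norm ranges over the whole unit ball of L^2; as a result,
    an operator norm of [eta] is obtained from a cut norm of order [eta ^+ 4]. *)

Record semi_inner (R : realType) (H : lmodType R) := SemiInner {
  inner :> H -> H -> R;
  innerC : forall x y, inner x y = inner y x;
  innerDl : forall x y z, inner (x + y) z = inner x z + inner y z;
  innerZl : forall a x y, inner (a *: x) y = a * inner x y;
  inner_ge0 : forall x, 0 <= inner x x }.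

(** * Semi-inner product spaces *)

Section SemiInner.
Context {R : realType} {H : lmodType R} (ip : semi_inner H).
Implicit Types (x y z h : H) (a b : R) (V : set H).

Lemma innerDr x y z : ip x (y + z) = ip x y + ip x z.
Proof. by rewrite innerC innerDl !(innerC ip x). Qed.

Lemma innerZr a x y : ip x (a *: y) = a * ip x y.
Proof. by rewrite innerC innerZl (innerC ip x). Qed.

Lemma inner0l x : ip 0 x = 0.
Proof. by rewrite -(scale0r 0) innerZl mul0r. Qed.

Lemma inner0r x : ip x 0 = 0.
Proof. by rewrite innerC inner0l. Qed.

Lemma innerNl x y : ip (- x) y = - ip x y.
Proof. by rewrite -scaleN1r innerZl mulN1r. Qed.

Lemma innerNr x y : ip x (- y) = - ip x y.
Proof. by rewrite innerC innerNl innerC. Qed.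

Lemma innerBl x y z : ip (x - y) z = ip x z - ip y z.
Proof. by rewrite innerDl innerNl. Qed.

Lemma innerBr x y z : ip x (y - z) = ip x y - ip x z.
Proof. by rewrite innerDr innerNr. Qed.

Lemma inner_suml (I : Type) (s : seq I) (P : pred I) (F : I -> H) y :
  ip (\sum_(i <- s | P i) F i) y = \sum_(i <- s | P i) ip (F i) y.
Proof.
elim/big_rec2: _ => [|i u v _ <-]; first by rewrite inner0l.
by rewrite innerDl.
Qed.

Lemma inner_sumr (I : Type) (s : seq I) (P : pred I) (F : I -> H) y :
  ip y (\sum_(i <- s | P i) F i) = \sum_(i <- s | P i) ip y (F i).
Proof. by rewrite innerC inner_suml; apply: eq_bigr => i _; rewrite innerC. Qed.

Definition seminorm x := Num.sqrt (ip x x).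
Local Notation N := seminorm.

Lemma seminorm_ge0 x : 0 <= N x.
Proof. exact: sqrtr_ge0. Qed.
#[local] Hint Resolve seminorm_ge0 : core.

Lemma seminorm_sqr x : N x ^+ 2 = ip x x.
Proof. by rewrite sqr_sqrtr ?inner_ge0. Qed.

Lemma seminorm0 : N 0 = 0.
Proof. by rewrite /N inner0l sqrtr0. Qed.

Lemma seminorm_eq0 x : (N x = 0) <-> (ip x x = 0).
Proof.
by split => [Nx|ix]; [rewrite -seminorm_sqr Nx expr0n|rewrite /N ix sqrtr0].
Qed.

Lemma seminormZ a x : N (a *: x) = `|a| * N x.
Proof.
by rewrite /N innerZl innerZr mulrA -expr2 sqrtrM ?sqr_ge0// sqrtr_sqr.
Qed.

Lemma seminormN x : N (- x) = N x.
Proof. by rewrite -scaleN1r seminormZ normrN1 mul1r. Qed.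

Lemma seminormB x y : N (x - y) = N (y - x).
Proof. by rewrite -seminormN opprB. Qed.

(* If [e] bounds how much moving [x] along [h] can decrease its square norm,
   then [x] is almost orthogonal to [h]; [e = ip x x] is Cauchy-Schwarz. *)
Lemma almost_orthogonal x h (e : R) : 0 <= e ->
  (forall t, ip x x - e <= ip (x - t *: h) (x - t *: h)) ->
  `|ip x h| <= Num.sqrt e * N h.
Proof.
move=> e0 le_e.
have expd t : 0 <= t ^+ 2 * ip h h - 2 * t * ip x h + e.
  have := le_e t; rewrite !(innerBl, innerBr, innerZl, innerZr) (innerC ip h x).
  nra.
rewrite -ler_sqr ?nnegrE ?mulr_ge0 ?sqrtr_ge0// exprMn seminorm_sqr.
rewrite sqr_sqrtr// real_normK ?num_real//.
have := inner_ge0 ip h; rewrite le_eqVlt => /orP[/eqP hh0|hh0].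
  rewrite -hh0 mulr0.
  have [->|xh0] := eqVneq (ip x h) 0; first by rewrite expr0n.
  (* When [h] is null the quadratic degenerates to a linear function of [t]; this [t] gives it the
     value -1. *)
  have := expd ((e + 1) / (2 * ip x h)).
  rewrite -hh0 mulr0 add0r.
  have -> : 2 * ((e + 1) / (2 * ip x h)) * ip x h = e + 1 by field.
  lra.
(* The minimiser of the quadratic in [t]. *)
have := expd (ip x h / ip h h).
have -> : (ip x h / ip h h) ^+ 2 * ip h h - 2 * (ip x h / ip h h) * ip x h + e
  = e - ip x h ^+ 2 / ip h h by field; rewrite gt_eqF.
by rewrite subr_ge0 ler_pdivrMr.
Qed.

Lemma cauchy_schwarz x y : `|ip x y| <= N x * N y.
Proof.
by apply: almost_orthogonal => [|t]; rewrite ?inner_ge0// subrr inner_ge0.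
Qed.

Lemma inner_null x y : N x = 0 -> ip x y = 0.
Proof.
move=> Nx; apply/eqP; rewrite -normr_eq0 eq_le normr_ge0 andbT.
by rewrite (le_trans (cauchy_schwarz _ _))// Nx mul0r.
Qed.

Lemma seminormD x y : N (x + y) <= N x + N y.
Proof.
rewrite -ler_sqr ?nnegrE ?addr_ge0// seminorm_sqr sqrrD !seminorm_sqr.
rewrite innerDl !innerDr (innerC ip y x).
have := le_trans (ler_norm _) (cauchy_schwarz x y).
by move: (N x * N y) => t ?; lra.
Qed.

Lemma seminorm_dist x y z : N (x - z) <= N (x - y) + N (y - z).
Proof.
rewrite -[x - z](subrK y) (le_trans _ (seminormD _ _))//.
by rewrite addrAC addrA subrK addrAC subrK.
Qed.

Lemma seminorm_null_add x y : N y = 0 -> N (x + y) = N x.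
Proof.
move=> Ny; apply/eqP; rewrite eq_le; apply/andP; split.
  by rewrite (le_trans (seminormD _ _))// Ny addr0.
by rewrite -{1}[x](addrK y) (le_trans (seminormD _ _))// seminormN Ny addr0.
Qed.

Lemma seminorm_null_orth x : (forall y, ip x y = 0) -> N x = 0.
Proof. by move=> x0; apply/seminorm_eq0. Qed.

Definition linear_subspace V :=
  [/\ V 0, (forall x y, V x -> V y -> V (x + y)) & forall a x, V x -> V (a *: x)].

Definition adherent V x := forall e, 0 < e -> exists2 v, V v & N (x - v) < e.

(** The explicit rate makes the distances between consecutive terms summable, so that completeness
    of L^2 can be proved without extracting a subsequence. *)
Definition fast_cauchy (u : nat -> H) :=
  forall m n, (m <= n)%N -> N (u m - u n) <= 2^-1 ^+ m.

Definition fast_complete := forall u, fast_cauchy u ->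
  exists x, (fun n => N (u n - x)) @ \oo --> (0 : R).

Lemma subspaceB V x y : linear_subspace V -> V x -> V y -> V (x - y).
Proof. by move=> [_ VD VZ] Vx Vy; apply: VD => //; rewrite -scaleN1r; exact: VZ. Qed.

Lemma cvg0_lt (u : nat -> R) e : u @ \oo --> (0 : R) -> 0 < e ->
  exists n0, forall n, (n0 <= n)%N -> `|u n| < e.
Proof.
by move=> /cvgr0Pnorm_lt u0 e0; have [n0 _ n0P] := u0 _ e0; exists n0.
Qed.

Lemma cvg0_intro (u : nat -> R) :
  (forall e, 0 < e -> exists n0, forall n, (n0 <= n)%N -> `|u n| < e) ->
  u @ \oo --> (0 : R).
Proof.
move=> u0; apply/cvgr0Pnorm_lt => e e0; have [n0 n0P] := u0 e e0.
by exists n0.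
Qed.

Lemma cvg_half_exp : (fun n => 2^-1 ^+ n : R) @ \oo --> (0 : R).
Proof. by apply: cvg_expr; rewrite ger0_norm; lra. Qed.

Lemma le_eps0 a b : 0 <= b -> (forall e, 0 < e -> a <= e * b) -> a <= 0.
Proof.
move=> b0 ab; apply/ler_addgt0Pr => e e0; rewrite add0r.
have b1 : 0 < b + 1 by lra.
rewrite (le_trans (ab (e / (b + 1)) _)) ?divr_gt0//.
by rewrite mulrAC ler_pdivrMr// ler_pM2l//; lra.
Qed.

(** * Orthogonal projection onto the closure of a subspace *)

Section Projection.
Hypothesis compl : fast_complete.
Variables (V : set H) (x : H).
Hypothesis subV : linear_subspace V.

(** Along a sequence [u] minimising the distance to [V], near-minimality makes [x - u n] almost
    orthogonal to [V]. Testing this against [u m - u n] bounds that difference at a geometric rate,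
    and orthogonality passes to the limit. The limit is only adherent, since [V] need not be
    closed. *)
Theorem exists_projection :
  exists2 g, adherent V g & forall v, V v -> ip (x - g) v = 0.
Proof.
have [V0 VD VZ] := subV.
pose E := [set r | exists2 v, V v & r = ip (x - v) (x - v)].
have infE : has_inf E.
  by split; [exists (ip (x - 0) (x - 0)); exists 0|exists 0 => _ [v _ ->]; exact: inner_ge0].
(* The factor one half gives [s m + s n <= 2^-1 ^+ m] for [m <= n], exactly the rate of
   [fast_cauchy]. *)
pose s n : R := 2^-1 * 2^-1 ^+ n.
have s_gt0 n : 0 < s n by rewrite mulr_gt0 ?exprn_gt0//; lra.
have exv n : exists v, V v /\ ip (x - v) (x - v) <= inf E + s n ^+ 2.
  have [_ [v Vv ->] lt_v] := inf_adherent (exprn_gt0 2 (s_gt0 n)) infE.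
  by exists v; split => //; exact: ltW.
have [u uP] := choice exv.
have u_orth n h : V h -> `|ip (x - u n) h| <= s n * N h.
  move=> Vh; have -> : s n = Num.sqrt (s n ^+ 2) by rewrite sqrtr_sqr gtr0_norm.
  apply: almost_orthogonal => [|t]; first exact: sqr_ge0.
  have [Vu lt_u] := uP n.
  rewrite lerBlDr (le_trans lt_u)// lerD2r.
  apply: (ge_inf infE.2); exists (u n + t *: h); first by apply: VD => //; exact: VZ.
  by rewrite opprD addrA.
have u_cauchy : fast_cauchy u.
  move=> m n mn.
  have sn : s n <= s m by rewrite ler_pM2l; [rewrite ler_wiXn2l//; lra|lra].
  have -> : 2^-1 ^+ m = s m + s m by rewrite /s; field.
  have Vmn : V (u m - u n) by apply: subspaceB => //; [case: (uP m)|case: (uP n)].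
  have := u_orth n _ Vmn; have := u_orth m _ Vmn => om on.
  have : N (u m - u n) ^+ 2 <= (s m + s m) * N (u m - u n).
    rewrite seminorm_sqr.
    have -> : ip (u m - u n) (u m - u n) =
        ip (x - u n) (u m - u n) - ip (x - u m) (u m - u n).
      by rewrite -innerBl; congr (ip _ _); rewrite opprB [RHS]addrC addrA subrK.
    have {}on := le_trans on (ler_wpM2r (seminorm_ge0 _) sn).
    have := ler_norm (ip (x - u n) (u m - u n)).
    have := ler_norm (- ip (x - u m) (u m - u n)); rewrite normrN.
    rewrite mulrDl; lra.
  have [->|N0] := eqVneq (N (u m - u n)) 0; first by rewrite addr_ge0// ltW.
  by rewrite expr2 ler_pM2r// lt_neqAle eq_sym N0 seminorm_ge0.
have [g ug] := compl u_cauchy.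
exists g.
  move=> e e0; have [n0 n0P] := cvg0_lt ug e0.
  exists (u n0); first by case: (uP n0).
  by rewrite seminormB; have := n0P _ (leqnn _); rewrite ger0_norm.
move=> v Vv; apply/eqP; rewrite -normr_le0.
apply: (@le_eps0 _ (N v + N v)); first by rewrite addr_ge0.
move=> e e0.
have [n1 n1P] := cvg0_lt ug e0.
have [n2 n2P] := cvg0_lt cvg_half_exp e0.
pose n := maxn n1 n2.
have := n1P n (leq_maxl _ _); rewrite ger0_norm// => un.
have := n2P n (leq_maxr _ _); rewrite ger0_norm ?exprn_ge0 ?invr_ge0// => hn.
have -> : ip (x - g) v = ip (x - u n) v + ip (u n - g) v.
  by rewrite -innerDl addrA subrK.
rewrite (le_trans (ler_normD _ _))// mulrDr lerD//.
  rewrite (le_trans (u_orth n v Vv))// ler_wpM2r//.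
  have : 0 <= 2^-1 ^+ n :> R by rewrite exprn_ge0 ?invr_ge0.
  rewrite /s; lra.
by rewrite (le_trans (cauchy_schwarz _ _))// ler_wpM2r// ltW.
Qed.

End Projection.

(** The residual of the projection of [x] is orthogonal to [V], hence null, so [x] is at distance
    zero from a vector adherent to [V]. *)
Lemma adherent_of_orth V : fast_complete -> linear_subspace V ->
  (forall w, (forall v, V v -> ip w v = 0) -> N w = 0) -> forall x, adherent V x.
Proof.
move=> compl subV orthV x; have [g gV gP] := exists_projection compl x subV.
move=> e e0; have [v Vv lt_v] := gV e e0; exists v => //.
rewrite (le_lt_trans _ lt_v)// (le_trans (seminorm_dist x g v))//.
by rewrite (orthV _ gP) add0r.
Qed.

Lemma weakly_null_dense (u : nat -> H) (C : R) V :
  (forall n, N (u n) <= C) -> (forall x, adherent V x) ->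
  (forall v, V v -> (fun n => ip (u n) v) @ \oo --> (0 : R)) ->
  forall x, (fun n => ip (u n) x) @ \oo --> (0 : R).
Proof.
move=> uC dV uV x; apply: cvg0_intro => e e0.
have C0 : 0 <= C := le_trans (seminorm_ge0 _) (uC 0%N).
have C1 : 0 < C + 1 by lra.
have e2 : 0 < e / 2 by lra.
have [v Vv xv] := dV x (e / 2 / (C + 1)) (divr_gt0 e2 C1).
have [n0 n0P] := cvg0_lt (uV v Vv) e2.
exists n0 => n /n0P uv.
have -> : ip (u n) x = ip (u n) v + ip (u n) (x - v).
  by rewrite innerBr addrC subrK.
rewrite (le_lt_trans (ler_normD _ _))// (splitr e) ltr_leD//.
rewrite (le_trans (cauchy_schwarz _ _))//.
rewrite (le_trans (ler_pM _ _ (uC n) (ltW xv)))//.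
by rewrite mulrA ler_pdivrMr// mulrDr mulr1 mulrC lerDl ltW.
Qed.

End SemiInner.

(** * Spectral theorem for compact self-adjoint contractions *)

Section CompactSelfadjoint.
Context {R : realType} {H : lmodType R} (ip : semi_inner H).
Local Notation N := (seminorm ip).
Implicit Types (x y z v w : H) (a l m : R) (A : set R).

(* Compactness is stated as complete continuity (bounded weakly null sequences
   have norm-null images), which avoids extracting subsequences. *)
Record compact_selfadjoint (T : {linear H -> H}) : Prop := CompactSelfadjoint {
  op_selfadjoint : forall x y, ip (T x) y = ip x (T y);
  op_contraction : forall x, N (T x) <= N x;
  op_compact : forall u : nat -> H, (forall n, N (u n) <= 1) ->
    (forall x, (fun n => ip (u n) x) @ \oo --> (0 : R)) ->
    (fun n => N (T (u n))) @ \oo --> (0 : R) }.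

(** For a contraction, null vectors qualify for every [l]. This is why bounds on eigenvalues are
    later written with a factor [N v] on both sides: they bind only where the eigenvector is not
    null. *)
Definition eigenvector (T : H -> H) l x := N (T x - l *: x) = 0.

Definition non_eigenvalue (T : H -> H) l := forall x, eigenvector T l x -> N x = 0.

(** One summand per eigenvalue: the summands are then pairwise orthogonal and Pythagoras applies. *)
Definition eigenspan (T : H -> H) A x := exists (s : seq R) (f : R -> H),
  [/\ uniq s, {in s, forall l, A l}, {in s, forall l, eigenvector T l (f l)} &
      x = \sum_(l <- s) f l].

Lemma cvg0_le (C : R) (u v : nat -> R) : 0 <= C ->
  (forall n, `|u n| <= C * `|v n|) -> v @ \oo --> (0 : R) -> u @ \oo --> (0 : R).
Proof.
move=> C0 uv v0; apply: cvg0_intro => e e0.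
have C1 : 0 < C + 1 by lra.
have [n0 n0P] := cvg0_lt v0 (divr_gt0 e0 C1).
exists n0 => n /n0P; rewrite ltr_pdivlMr// => vn.
apply: le_lt_trans (uv n) _; apply: le_lt_trans vn.
by rewrite mulrC ler_wpM2l//; lra.
Qed.

Section OneOperator.
Context (T : {linear H -> H}) (cT : compact_selfadjoint T).
Local Notation eig := (eigenvector T).

Let opZ c z : T (c *: z) = c *: T z. Proof. by rewrite linearZ. Qed.

Lemma eig_inner l x y : eig l x -> ip (T x) y = l * ip x y.
Proof.
move=> /(@inner_null _ _ ip _ y); rewrite innerBl innerZl => /eqP.
by rewrite subr_eq0 => /eqP.
Qed.

Lemma eig_norm l x : eig l x -> N (T x) = `|l| * N x.
Proof.
by move=> lx; rewrite -[T x](subrK (l *: x)) addrC seminorm_null_add// seminormZ.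
Qed.

Lemma eig_subspace l : linear_subspace (eig l).
Proof.
rewrite /eigenvector; split.
- by rewrite raddf0 scaler0 subr0 seminorm0.
- by move=> x y lx ly; rewrite linearD scalerDr opprD addrACA seminorm_null_add.
- by move=> a x lx; rewrite opZ scalerA mulrC -scalerA -scalerBr seminormZ lx mulr0.
Qed.

Lemma eig_orth l m x y : l != m -> eig l x -> eig m y -> ip x y = 0.
Proof.
move=> lm lx my; have := op_selfadjoint cT x y.
rewrite (eig_inner _ lx) (innerC ip x (T y)) (eig_inner _ my) => /eqP; rewrite (innerC ip y).
by rewrite -subr_eq0 -mulrBl mulf_eq0 subr_eq0 (negbTE lm) /= => /eqP.
Qed.

Lemma eig_span A l x : A l -> eig l x -> eigenspan T A x.
Proof.
move=> Al lx; exists [:: l], (fun=> x); split => //.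
- by move=> m; rewrite inE => /eqP ->.
- by move=> m; rewrite inE => /eqP ->.
- by rewrite big_seq1.
Qed.

Lemma eigenspan_subspace A : linear_subspace (eigenspan T A).
Proof.
split.
- by exists [::], (fun=> 0); split => //; rewrite big_nil.
- move=> x y [s [f [us As es ->]]] [t [g [ut At et ->]]].
  exists (undup (s ++ t)), (fun l => (if l \in s then f l else 0) + (if l \in t then g l else 0)).
  split; first exact: undup_uniq.
  + by move=> l; rewrite mem_undup mem_cat => /orP[/As|/At].
  + move=> l _; have [e0 eD eZ] := eig_subspace l.
    by apply: eD; [case: ifP => // /es|case: ifP => // /et].
  + rewrite big_split /= -!big_mkcond /= -!(big_filter _ (fun i => i \in _)).
    congr (_ + _); apply: perm_big; apply: uniq_perm => //;
      rewrite ?filter_uniq ?undup_uniq// => l;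
      by rewrite mem_filter mem_undup mem_cat; case: (l \in s); case: (l \in t).
- move=> a x [s [f [us As es ->]]]; exists s, (fun l => a *: f l); split => //.
  + by move=> l ls; have [e0 eD eZ] := eig_subspace l; apply/eZ/es.
  + by rewrite scaler_sumr.
Qed.

Lemma eigenspan_orth A w : (forall l v, A l -> eig l v -> ip w v = 0) ->
  forall x, eigenspan T A x -> ip w x = 0.
Proof.
move=> wA x [s [f [us As es ->]]]; rewrite inner_sumr big1_seq// => l /andP[_ ls].
by apply: (wA l); [exact: As|exact: es].
Qed.

Section Spectral.
Hypothesis compl : fast_complete ip.

(** Without such a bound there are unit vectors [u n] with [(T - a) (u n)] tending to 0. Their inner
    products with the range of [T - a] vanish in the limit, and this range is dense because its
    orthogonal complement is the kernel of [T - a], which is null. So [u] is weakly null,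
    compactness sends [T (u n)] to 0, and [a *: u n], of constant norm [|a| > 0], would tend to 0 as
    well. *)
Lemma non_eigenvalue_lower_bound a : a != 0 -> non_eigenvalue T a ->
  exists2 d, 0 < d & forall x, d * N x <= N (T x - a *: x).
Proof.
move=> a0 na; apply: contrapT => nd.
have exu n : exists x, N x = 1 /\ N (T x - a *: x) <= 2^-1 ^+ n.
  have hn : 0 < 2^-1 ^+ n :> R by rewrite exprn_gt0//; lra.
  have [x xn] : exists x, N (T x - a *: x) < 2^-1 ^+ n * N x.
    apply: contrapT => nx; apply: nd; exists (2^-1 ^+ n) => // x.
    by rewrite leNgt; apply/negP => ?; apply: nx; exists x.
  have x0 : 0 < N x.
    by rewrite -(pmulr_rgt0 _ hn) (le_lt_trans _ xn)// seminorm_ge0.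
  exists ((N x)^-1 *: x); split.
    by rewrite seminormZ ger0_norm ?invr_ge0 ?seminorm_ge0// mulVf// gt_eqF.
  rewrite opZ scalerA mulrC -scalerA -scalerBr seminormZ.
  by rewrite ger0_norm ?invr_ge0 ?seminorm_ge0// mulrC ler_pdivrMr// ltW.
have [u uP] := choice exu.
pose V := [set y | exists z, y = T z - a *: z].
have subV : linear_subspace V.
  split.
  - by exists 0; rewrite raddf0 scaler0 subr0.
  - by move=> _ _ [x ->] [y ->]; exists (x + y); rewrite linearD scalerDr opprD addrACA.
  - by move=> b _ [x ->]; exists (b *: x); rewrite opZ scalerBr !scalerA mulrC.
have shift x z : ip x (T z - a *: z) = ip (T x - a *: x) z.
  by rewrite innerBr innerBl innerZr innerZl (op_selfadjoint cT).
have denseV : forall x, adherent ip V x.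
  apply: adherent_of_orth => // w wV; apply: na; apply: seminorm_null_orth => z.
  by rewrite -shift wV//; exists z.
have uweak : forall x, (fun n => ip (u n) x) @ \oo --> (0 : R).
  apply: (@weakly_null_dense _ _ ip u 1 V) => //.
    by move=> n; rewrite (uP n).1.
  move=> _ [z ->]; apply: (@cvg0_le (N z)) (@cvg_half_exp R).
    exact: seminorm_ge0.
  move=> n; rewrite shift (le_trans (cauchy_schwarz _ _ _))// mulrC.
  rewrite ler_wpM2l ?seminorm_ge0//.
  by rewrite (le_trans (uP n).2)// ler_norm.
have u1 n : N (u n) <= 1 by rewrite (uP n).1.
have Tu := op_compact cT u1 uweak.
have : (fun n => N (T (u n)) + 2^-1 ^+ n) @ \oo --> (0 + 0 : R).
  exact: cvgD Tu (@cvg_half_exp R).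
have a1 : 0 < `|a| by rewrite normr_gt0.
rewrite addr0 => /cvg0_lt /(_ a1) [n /(_ n (leqnn n))].
apply/negP; rewrite -leNgt (le_trans _ (ler_norm _))//.
have -> : `|a| = N (a *: u n) by rewrite seminormZ (uP n).1 mulr1.
rewrite -{1}[a *: u n](subrK (T (u n))) addrC (le_trans (seminormD _ _ _))//.
by rewrite lerD2l seminormB (uP n).2.
Qed.

(** The space [M] of vectors orthogonal to all eigenvectors is stable under [T]. Suppose [rho], the
    supremum of the square of [N (T v)] over the unit ball of [M], is positive. A maximising
    sequence is almost annihilated by [T^2 - rho], whose kernel in [M] is null, so the sequence is
    weakly null. Compactness then sends [T (u n)] to 0, whereas the square of its norm tends to
    [rho]. *)
Theorem eigenspan_dense x : adherent ip (eigenspan T setT) x.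
Proof.
apply: adherent_of_orth => //; first exact: eigenspan_subspace.
pose M w := forall l v, eig l v -> ip w v = 0.
suff M0 w : M w -> N w = 0.
  by move=> w wV; apply: M0 => l v lv; apply: wV; exact: eig_span lv.
have M_eig l v : M v -> eig l v -> N v = 0.
  by move=> Mv lv; apply/seminorm_eq0; exact: Mv lv.
have MT v : M v -> M (T v).
  by move=> Mv l z lz; rewrite (op_selfadjoint cT) innerC (eig_inner _ lz) innerC (Mv l)// mulr0.
have MD v z a : M v -> M z -> M (v + a *: z).
  by move=> Mv Mz l t lt; rewrite innerDl innerZl (Mv l)// (Mz l)// mulr0 addr0.
pose E := [set r | exists2 v, M v & N v <= 1 /\ r = ip (T v) (T v)].
have supE : has_sup E.
  split.
    exists (ip (T 0) (T 0)); exists 0; last by rewrite seminorm0.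
    by move=> l v _; rewrite inner0l.
  exists 1 => _ [v _ [v1 ->]]; rewrite -seminorm_sqr expr_le1 ?seminorm_ge0//.
  exact: le_trans (op_contraction cT v) v1.
pose rho := sup E.
have rho_ub v : M v -> ip (T v) (T v) <= rho * ip v v.
  move=> Mv; have [v0|v0] := eqVneq (N v) 0.
    have := op_contraction cT v; rewrite v0 => Tv0.
    have -> : ip v v = 0 by apply/seminorm_eq0.
    rewrite mulr0 -seminorm_sqr.
    have /eqP -> : N (T v) == 0 by rewrite eq_le Tv0 seminorm_ge0.
    by rewrite expr0n.
  have Nv : 0 < N v by rewrite lt_neqAle eq_sym v0 seminorm_ge0.
  have : E (ip (T ((N v)^-1 *: v)) (T ((N v)^-1 *: v))).
    exists ((N v)^-1 *: v); first by move=> l z lz; rewrite innerZl (Mv l)// mulr0.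
    split => //; rewrite seminormZ ger0_norm ?invr_ge0 ?seminorm_ge0//.
    by rewrite mulVf.
  move=> /(ub_le_sup supE.2); rewrite opZ innerZl innerZr mulrA -/rho.
  by rewrite -invfM -expr2 seminorm_sqr mulrC ler_pdivrMr// -seminorm_sqr exprn_gt0.
(* If [rho] is not positive, [T] vanishes on [M] up to null vectors, and [w] is an eigenvector for 0
   orthogonal to itself. *)
have [w0|rho0] := leP rho 0.
  move=> Mw; apply: (M_eig 0) => //; rewrite /eigenvector scale0r subr0.
  apply/seminorm_eq0/le_anti; rewrite inner_ge0 andbT (le_trans (rho_ub _ Mw))//.
  by rewrite mulr_le0_ge0 ?inner_ge0.
have exu n : exists v, [/\ M v, N v <= 1 & rho - (2^-1 ^+ n) ^+ 2 < ip (T v) (T v)].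
  have hn : 0 < (2^-1 ^+ n) ^+ 2 :> R by rewrite !exprn_gt0//; lra.
  have [_ [v Mv [v1 ->]] lt_v] := sup_adherent hn supE.
  by exists v.
have [u uP] := choice exu.
(* The orthogonal complement of [M] plus the range of [T^2 - rho]. The first summand contains the
   eigenvectors, so whatever is orthogonal to [V] lies in [M]; it contributes nothing to inner
   products with [u n], which belongs to [M]. *)
pose V := [set y | exists v z, (forall w, M w -> ip w v = 0) /\ y = v + (T (T z) - rho *: z)].
have subV : linear_subspace V.
  split.
  - exists 0, 0; split; first by move=> *; rewrite inner0r.
    by rewrite !(raddf0, scaler0, subr0, addr0).
  - move=> _ _ [v [z [Mv ->]]] [v' [z' [Mv' ->]]]; exists (v + v'), (z + z'); split.
      by move=> y My; rewrite innerDr Mv// Mv'// addr0.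
    by rewrite !linearD /= addrACA; congr (_ + _); rewrite addrACA.
  - move=> b _ [v [z [Mv ->]]]; exists (b *: v), (b *: z); split.
      by move=> y My; rewrite innerZr Mv// mulr0.
    by rewrite !opZ scalerDr scalerBr !scalerA mulrC.
have shift y z : ip y (T (T z) - rho *: z) = ip (T (T y) - rho *: y) z.
  by rewrite innerBr innerBl innerZr innerZl !(op_selfadjoint cT).
(* Factor [T^2 - rho] as [(T - r) (T + r)]: an element of the kernel in [M] yields eigenvectors in
   [M] for [r], then for [- r], and these are null. *)
have ker0 y : M y -> N (T (T y) - rho *: y) = 0 -> N y = 0.
  move=> My y0; pose r := Num.sqrt rho.
  have rr : r * r = rho by rewrite -expr2 sqr_sqrtr// ltW.
  apply: (M_eig (- r)) => //; rewrite /eigenvector scaleNr opprK.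
  apply: (M_eig r); first by apply: MD => //; exact: MT.
  rewrite /eigenvector -[RHS]y0; congr N.
  by rewrite raddfD /= opZ scalerDr scalerA rr opprD addrA addrK.
have denseV : forall x, adherent ip V x.
  apply: adherent_of_orth => // y yV; apply: ker0.
    move=> l v lv; apply: yV; exists v, 0; split; first by move=> w' Mw'; exact: Mw' lv.
    by rewrite !(raddf0, scaler0, subr0, addr0).
  apply: seminorm_null_orth => z; rewrite -shift yV//.
  by exists 0, z; rewrite add0r; split => // *; rewrite inner0r.
(* Expanding the square and bounding the square norm of [T (T (u n))] by [rho] times that of
   [T (u n)] leaves at most [rho] times the defect of [u n] from the supremum; this is why the
   defect was chosen as a square. *)
have small n : N (T (T (u n)) - rho *: u n) <= Num.sqrt rho * 2^-1 ^+ n.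
  have [Mu u1 ltu] := uP n.
  have h0 : 0 <= 2^-1 ^+ n :> R by rewrite exprn_ge0// invr_ge0.
  rewrite -ler_sqr ?nnegrE ?seminorm_ge0 ?mulr_ge0 ?sqrtr_ge0// exprMn.
  rewrite seminorm_sqr (sqr_sqrtr (ltW rho0)) !(innerBl, innerBr, innerZl, innerZr).
  rewrite (innerC ip (u n)) !(op_selfadjoint cT _ (u n)).
  have := rho_ub _ (MT _ Mu).
  have uu : ip (u n) (u n) <= 1.
    by rewrite -seminorm_sqr expr_le1// seminorm_ge0.
  move: ltu uu; move: (ip (T (u n)) _) (ip (u n) _) (ip (T (T _)) _) ((2^-1 ^+ n) ^+ 2).
  move=> t s r e; nra.
have uweak : forall x, (fun n => ip (u n) x) @ \oo --> (0 : R).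
  apply: (@weakly_null_dense _ _ ip u 1 V) => //.
    by move=> n; have [] := uP n.
  move=> _ [v [z [Mv ->]]].
  apply: (@cvg0_le (Num.sqrt rho * N z)) (@cvg_half_exp R).
    by rewrite mulr_ge0 ?sqrtr_ge0 ?seminorm_ge0.
  move=> n; have [Mu _ _] := uP n.
  rewrite innerDr Mv// add0r shift (le_trans (cauchy_schwarz _ _ _))//.
  rewrite mulrAC ler_wpM2r ?seminorm_ge0// (le_trans (small n))//.
  by rewrite ler_wpM2l ?sqrtr_ge0// ler_norm.
have u1 n : N (u n) <= 1 by have [] := uP n.
have Tu := op_compact cT u1 uweak.
have : (fun n => N (T (u n)) * N (T (u n)) + 2^-1 ^+ n * 2^-1 ^+ n) @ \oo --> (0 * 0 + 0 * 0 : R).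
  by apply: cvgD; apply: cvgM => //; exact: cvg_half_exp.
rewrite !mulr0 addr0 => /cvg0_lt /(_ rho0) [n /(_ n (leqnn n))].
have [_ _] := uP n; rewrite -seminorm_sqr !expr2.
have := ler_norm (N (T (u n)) * N (T (u n)) + 2^-1 ^+ n * 2^-1 ^+ n).
by move=> *; exfalso; lra.
Qed.

End Spectral.
End OneOperator.
End CompactSelfadjoint.

(** * Density of the non-eigenvalues *)

Section NonEigenvalues.
Context {R : realType} {H : lmodType R} (ip : semi_inner H).
Context (T : {linear H -> H}) (cT : compact_selfadjoint ip T).
Hypothesis compl : fast_complete ip.
Local Notation N := (seminorm ip).
Local Notation eig := (eigenvector ip T).

(* Otherwise there is a sequence of unit eigenvectors with distinct eigenvalues
   bounded away from zero: it is weakly null because the eigenvectors span. *)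
Let exists_non_eigenvalue_away0 (x y c : R) : x < y -> 0 < c ->
  (forall t, x < t < y -> c <= `|t|) ->
  exists2 d, x < d < y & non_eigenvalue ip T d.
Proof.
move=> xy c0 cP; apply: contrapT => nd.
pose l n := x + (y - x) * 2^-1 ^+ n.+1.
have half_lt1 n : 2^-1 ^+ n.+1 < 1 :> R by rewrite exprn_ilt1 ?invr_ge0//; lra.
have lxy n : x < l n < y.
  rewrite /l ltrDl -ltrBrDl mulr_gt0 ?exprn_gt0 ?subr_gt0 ?invr_gt0//=.
  by rewrite gtr_pMr ?subr_gt0.
have l_inj : injective l.
  move=> m n /addrI /mulfI; rewrite subr_eq0 gt_eqF// => /(_ isT).
  move=> /(ieexprIn _ _) lmn; apply/eqP; rewrite -eqSS; apply/eqP/lmn.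
    by rewrite invr_gt0.
  by rewrite neq_lt; apply/orP; left; lra.
have exu n : exists v, eig (l n) v /\ N v = 1.
  have [v lv v0] : exists2 v, eig (l n) v & N v <> 0.
    apply: contrapT => nv; apply: nd; exists (l n) => // v lv.
    by apply: contrapT => v0; apply: nv; exists v.
  have [_ _ eZ] := eig_subspace ip T (l n).
  exists ((N v)^-1 *: v); split; first exact: eZ.
  rewrite seminormZ ger0_norm ?invr_ge0 ?seminorm_ge0// mulVf//.
  exact/eqP.
have [u uP] := choice exu.
have uweak : forall z, (fun n => ip (u n) z) @ \oo --> (0 : R).
  apply: (@weakly_null_dense _ _ ip u 1 (eigenspan ip T setT)).
  - by move=> n; rewrite (uP n).2.
  - exact: eigenspan_dense.
  - move=> _ [s [f [_ _ es ->]]]; apply: cvg0_intro => e e0.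
    (* A finite list meets the injective sequence [l] finitely often; beyond that, [u n] is
       orthogonal to every summand. *)
    have [n0 n0P] : exists n0, forall n, (n0 <= n)%N -> l n \notin s.
      elim: s {es} => [|m s [n0 n0P]]; first by exists 0%N.
      have [[k km]|nk] := pselect (exists k, l k = m).
        exists (maxn n0 k.+1) => n; rewrite geq_max => /andP[/n0P ns kn].
        rewrite inE negb_or ns andbT -km; apply/eqP => /l_inj nk.
        by rewrite nk ltnn in kn.
      exists n0 => n /n0P ns; rewrite inE negb_or ns andbT.
      by apply/eqP => nm; apply: nk; exists n.
    exists n0 => n /n0P ns.
    rewrite inner_sumr big1_seq ?normr0// => m /andP[_ ms].
    apply: (eig_orth cT _ (uP n).1 (es m ms)).
    by apply: contra ns => /eqP ->.
have u1 n : N (u n) <= 1 by rewrite (uP n).2.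
have /cvg0_lt /(_ c0) [n /(_ n (leqnn n))] := op_compact cT u1 uweak.
apply/negP; rewrite -leNgt ger0_norm ?seminorm_ge0//.
by rewrite (eig_norm (uP n).1) (uP n).2 mulr1 cP.
Qed.

(** Nonzero eigenvalues accumulate only at 0, so it is enough to pass to a subinterval at positive
    distance [c] from 0: near [y] when [y] is positive, and the left half otherwise. *)
Theorem exists_non_eigenvalue (x y : R) : x < y ->
  exists d, [/\ d != 0, non_eigenvalue ip T d & x < d < y].
Proof.
move=> xy.
suff [x' [y' [c [xx' x'y' y'y c0 cP]]]] : exists x' y' c, [/\ x <= x', x' < y', y' <= y, 0 < c &
    forall t, x' < t < y' -> c <= `|t|].
  have [d /andP[x'd dy'] nd] := exists_non_eigenvalue_away0 x'y' c0 cP.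
  exists d; split => //; last by rewrite (le_lt_trans xx')//= (lt_le_trans dy').
  by rewrite -normr_gt0 (lt_le_trans c0)// cP// x'd.
have [y0|y0] := ltP 0 y.
  exists (Num.max x (y / 2)), y, (y / 2); split => //.
  - by rewrite le_max lexx.
  - by rewrite gt_max xy/=; lra.
  - lra.
  - move=> t; rewrite gt_max -andbA => /and3P[_ t0 _].
    by rewrite (le_trans _ (ler_norm _))// ltW.
exists x, ((x + y) / 2), (- ((x + y) / 2)); split => //; try lra.
move=> t /andP[_ t1]; rewrite -normrN (le_trans _ (ler_norm _))//; lra.
Qed.

End NonEigenvalues.

(** * Angles between spectral subspaces and perturbation of spectral projections *)

Section Angle.
Context {R : realType} {H : lmodType R} (ip : semi_inner H).
Local Notation N := (seminorm ip).
Local Notation eig := (eigenvector ip).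
Local Notation span := (eigenspan ip).
Local Notation compact_sa := (compact_selfadjoint ip).
Implicit Types (T S : {linear H -> H}) (A B : set R) (c r d eta : R).

Lemma pythagoras (s : seq R) (f : R -> H) (a : R -> R) : uniq s ->
  (forall l m, l \in s -> m \in s -> l != m -> ip (f l) (f m) = 0) ->
  ip (\sum_(l <- s) a l *: f l) (\sum_(l <- s) a l *: f l) =
  \sum_(l <- s) a l ^+ 2 * ip (f l) (f l).
Proof.
move=> us orth; rewrite inner_suml; apply: eq_big_seq => l ls.
rewrite inner_sumr (bigD1_seq l)//= big1_seq ?addr0.
  by rewrite innerZl innerZr mulrA.
move=> m /andP[lm ms]; rewrite innerZl innerZr orth ?mulr0//.
by rewrite eq_sym.
Qed.

Let span_orth T (s : seq R) f : compact_sa T ->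
  {in s, forall l, eig T l (f l)} ->
  forall l m, l \in s -> m \in s -> l != m -> ip (f l) (f m) = 0.
Proof. by move=> cT es l m ls ms lm; exact (eig_orth cT lm (es l ls) (es m ms)). Qed.

(** The norm bound of functional calculus: a function of the operator acts on the component at [l]
    as multiplication by [a l]. *)
Lemma eigenspan_scaled T (a : R -> R) (k : R) (s : seq R) (f : R -> H) :
  compact_sa T -> 0 <= k -> uniq s -> {in s, forall l, eig T l (f l)} ->
  {in s, forall l, `|a l| * N (f l) <= k * N (f l)} ->
  N (\sum_(l <- s) a l *: f l) <= k * N (\sum_(l <- s) f l).
Proof.
move=> cT k0 us es ak; rewrite -ler_sqr ?nnegrE ?mulr_ge0 ?seminorm_ge0//.
rewrite exprMn !seminorm_sqr pythagoras//; last exact: span_orth es.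
have -> : \sum_(l <- s) f l = \sum_(l <- s) 1 *: f l.
  by apply: eq_bigr => l _; rewrite scale1r.
rewrite pythagoras//; last exact: span_orth es.
rewrite mulr_sumr big_seq [leRHS]big_seq; apply: ler_sum => l ls.
rewrite expr1n mul1r -!seminorm_sqr -!exprMn.
rewrite -(real_normK (num_real (a l * _))) ler_sqr ?nnegrE ?mulr_ge0 ?seminorm_ge0//.
by rewrite normrM (ger0_norm (seminorm_ge0 _ _)) ak.
Qed.

(** Here [x'] stands for [(T - c) x], which agrees with an element of the span only up to a null
    vector; hence the equality of inner products. *)
Lemma eigenspan_shift T A c r x : compact_sa T -> 0 <= r ->
  (forall l v, A l -> eig T l v -> `|l - c| * N v <= r * N v) -> span T A x ->
  exists x', [/\ span T A x', N x' <= r * N x & forall z, ip (T x - c *: x) z = ip x' z].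
Proof.
move=> cT r0 HA [s [f [us As es ->]]].
exists (\sum_(l <- s) (l - c) *: f l); split.
- exists s, (fun l => (l - c) *: f l); split => // l ls.
  by have [_ _ eZ] := eig_subspace ip T l; apply/eZ/es.
- by apply: (eigenspan_scaled cT) => // l ls; apply: HA; [exact: As|exact: es].
- move=> z; rewrite innerBl innerZl raddf_sum !inner_suml mulr_sumr -sumrB.
  by apply: eq_big_seq => l ls; rewrite (eig_inner _ (es l ls)) innerZl mulrBl.
Qed.

(** Componentwise division by [l - c]. The hypothesis lets [l - c] vanish only where the component
    is null, and there the value of the inverse does not matter. *)
Lemma eigenspan_shift_inv T A c r x : compact_sa T -> 0 < r ->
  (forall l v, A l -> eig T l v -> r * N v <= `|l - c| * N v) -> span T A x ->
  exists x', [/\ span T A x', N x' <= r^-1 * N x & forall z, ip (T x' - c *: x') z = ip x z].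
Proof.
move=> cT r0 HA [s [f [us As es ->]]].
exists (\sum_(l <- s) (l - c)^-1 *: f l); split.
- exists s, (fun l => (l - c)^-1 *: f l); split => // l ls.
  by have [_ _ eZ] := eig_subspace ip T l; apply/eZ/es.
- apply: (eigenspan_scaled cT) => //; first by rewrite invr_ge0 ltW.
  move=> l ls; have := HA l (f l) (As l ls) (es l ls).
  have [->|f0] := eqVneq (N (f l)) 0; first by rewrite !mulr0.
  have fl : 0 < N (f l) by rewrite lt_neqAle eq_sym f0 seminorm_ge0.
  rewrite !ler_pM2r// => rl; rewrite normrV ?unitfE -?normr_gt0 ?(lt_le_trans r0)//.
  by rewrite lef_pV2 ?posrE// (lt_le_trans r0).
- move=> z; rewrite innerBl innerZl raddf_sum !inner_suml mulr_sumr -sumrB.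
  apply: eq_big_seq => l ls; have ef := es l ls.
  have [_ _ eZ] := eig_subspace ip T l.
  rewrite (eig_inner z (eZ _ _ ef)) innerZl -mulrBl.
  have [f0|f0] := eqVneq (N (f l)) 0; first by rewrite inner_null// !mulr0.
  have fl : 0 < N (f l) by rewrite lt_neqAle eq_sym f0 seminorm_ge0.
  have := HA l (f l) (As l ls) ef; rewrite ler_pM2r// => rl.
  by rewrite mulrA mulfV ?mul1r// -normr_gt0 (lt_le_trans r0).
Qed.

(* A Davis-Kahan estimate. Writing [y = (S - c) y'], self-adjointness turns
   [ip x y] into [ip x' y'] with [x' = (T - c) x], up to [eta]; this contracts
   by the factor [r / (r + d)], and one iterates. *)
Lemma eigenspan_angle T S A B c r d eta : compact_sa T -> compact_sa S ->
  0 <= r -> 0 < d -> 0 <= eta ->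
  (forall l v, A l -> eig T l v -> `|l - c| * N v <= r * N v) ->
  (forall l v, B l -> eig S l v -> (r + d) * N v <= `|l - c| * N v) ->
  (forall x, N (T x - S x) <= eta * N x) ->
  forall x y, span T A x -> span S B y -> `|ip x y| <= eta / d * (N x * N y).
Proof.
move=> cT cS r0 d0 eta0 HA HB TS.
have rd : 0 < r + d by lra.
pose q := r / (r + d).
have q01 : 0 <= q < 1.
  rewrite /q; apply/andP; split; first by rewrite divr_ge0// ltW.
  rewrite ltr_pdivrMr//; lra.
have [q0 q1] := andP q01.
have step n : forall x y, span T A x -> span S B y ->
    `|ip x y| <= (q ^+ n + eta / d) * (N x * N y).
  elim: n => [|n IH] x y xA yB.
    rewrite expr0 mulrDl mul1r (le_trans (cauchy_schwarz _ _ _))// lerDl.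
    by rewrite !mulr_ge0 ?seminorm_ge0// invr_ge0 ltW.
  have [x' [x'A Nx' x'P]] := eigenspan_shift cT r0 HA xA.
  have [y' [y'B Ny' y'P]] := eigenspan_shift_inv cS rd HB yB.
  have -> : ip x y = ip x' y' - ip (T x - S x) y'.
    have e1 := y'P x; have e2 := x'P y'; have e3 := op_selfadjoint cS x y'.
    rewrite !(innerBl, innerZl) in e1 e2 *.
    rewrite (innerC ip (S y') x) (innerC ip y' x) (innerC ip y x) in e1; lra.
  have k0 : 0 <= q ^+ n + eta / d.
    by apply: addr_ge0; [exact: exprn_ge0|apply: divr_ge0 => //; exact: ltW].
  have h1 := le_trans (IH _ _ x'A y'B)
    (ler_wpM2l k0 (ler_pM (seminorm_ge0 _ _) (seminorm_ge0 _ _) Nx' Ny')).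
  have h2 := le_trans (cauchy_schwarz ip (T x - S x) y')
    (ler_pM (seminorm_ge0 _ _) (seminorm_ge0 _ _) (TS x) Ny').
  rewrite (le_trans (ler_normB _ _))// (le_trans (lerD h1 h2))//.
  (* [eta / d] is the fixed point of [k |-> q * k + eta / (r + d)], the recursion satisfied by the
     constant. *)
  rewrite le_eqVlt; apply/orP; left; apply/eqP; rewrite exprS {2}/q.
  by field; rewrite !gt_eqF.
move=> x y xA yB; rewrite -subr_le0.
apply: (@le_eps0 _ _ (N x * N y)); first by rewrite mulr_ge0 ?seminorm_ge0.
move=> e e0.
have qn : (fun n => q ^+ n) @ \oo --> (0 : R).
  by apply: cvg_expr; rewrite ger0_norm.
have [n /(_ n (leqnn n))] := cvg0_lt qn e0.
move=> /(le_lt_trans (ler_norm _)) /ltW qe.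
rewrite lerBlDr -mulrDl (le_trans (step n x y xA yB))//.
by rewrite ler_wpM2r ?mulr_ge0 ?seminorm_ge0// lerD2r.
Qed.

Lemma adherent_angle (V W : set H) (k : R) : 0 <= k ->
  (forall x y, V x -> W y -> `|ip x y| <= k * (N x * N y)) ->
  forall x y, adherent ip V x -> adherent ip W y -> `|ip x y| <= k * (N x * N y).
Proof.
move=> k0 VW x y xV yW; rewrite -subr_le0.
have [a0 b0] := (seminorm_ge0 ip x, seminorm_ge0 ip y).
apply: (@le_eps0 _ _ (k * (N x + N y + 1) + (N x + 1 + N y))).
  by rewrite addr_ge0 ?mulr_ge0 ?addr_ge0.
(* Capping the tolerance at 1 turns the terms quadratic in [e] into linear ones. *)
move=> e0 e00; pose e := Num.min e0 1.
have e_gt0 : 0 < e by rewrite lt_min e00 ltr01.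
have e1 : e <= 1 by rewrite ge_min lexx orbT.
have ee0 : e <= e0 by rewrite ge_min lexx.
apply: (@le_trans _ _ (e * (k * (N x + N y + 1) + (N x + 1 + N y)))); last first.
  by rewrite ler_wpM2r// addr_ge0 ?mulr_ge0 ?addr_ge0.
have [v Vv xv] := xV e e_gt0; have [w Ww yw] := yW e e_gt0.
have Nv : N v <= N x + e.
  by rewrite -[v](subrK x) addrC (le_trans (seminormD _ _ _))// lerD2l seminormB ltW.
have Nw : N w <= N y + e.
  by rewrite -[w](subrK y) addrC (le_trans (seminormD _ _ _))// lerD2l seminormB ltW.
have -> : ip x y = ip v w + ip v (y - w) + ip (x - v) y.
  by rewrite innerBr innerBl [ip v w + _]addrC subrK addrC subrK.
have h1 : `|ip v w| <= k * ((N x + e) * (N y + e)).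
  by rewrite (le_trans (VW v w Vv Ww))// ler_wpM2l// ler_pM ?seminorm_ge0.
have h2 : `|ip v (y - w)| <= (N x + e) * e.
  by rewrite (le_trans (cauchy_schwarz _ _ _))// ler_pM ?seminorm_ge0// ltW.
have h3 : `|ip (x - v) y| <= e * N y.
  by rewrite (le_trans (cauchy_schwarz _ _ _))// ler_wpM2r ?seminorm_ge0// ltW.
have h4 : k * ((N x + e) * (N y + e)) <= k * (N x * N y) + e * (k * (N x + N y + 1)).
  rewrite [e * _]mulrCA -mulrDr ler_wpM2l//.
  by have := ler_wpM2l (ltW e_gt0) e1; nra.
have h5 : (N x + e) * e <= e * (N x + 1) by rewrite mulrC ler_wpM2l ?(ltW e_gt0)// lerD2l.
have := le_trans (ler_normD (ip v w + ip v (y - w)) (ip (x - v) y)) (lerD (ler_normD _ _) (lexx _)).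
lra.
Qed.

(** A relation, because the projection of [f] onto the closed span of the eigenvectors over [A] is
    determined only up to a null vector. *)
Definition spectral_proj T A (f g : H) := adherent ip (span T A) g /\
  forall l v, A l -> eig T l v -> ip (f - g) v = 0.

Section Complement.
Hypothesis compl : fast_complete ip.
Context (T : {linear H -> H}) (cT : compact_sa T).

(** Approximate [w] by a finite sum of eigenvectors and drop the part [hA] with eigenvalues in [A].
    That part is orthogonal to [w] and to the rest, so its norm is at most the approximation error,
    and dropping it at most doubles the error. *)
Lemma eigenspan_compl A w : (forall l v, A l -> eig T l v -> ip w v = 0) ->
  adherent ip (span T (~` A)) w.
Proof.
move=> wA e e0; have e2 : 0 < e / 2 by lra.
have [_ [s [f [us _ es ->]]] lt_wh] := eigenspan_dense cT compl w e2.
pose p := fun l => `[< A l >].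
pose hA := \sum_(l <- s | p l) f l; pose hB := \sum_(l <- s | ~~ p l) f l.
have hE : \sum_(l <- s) f l = hA + hB by rewrite (bigID p).
exists hB.
  exists [seq l <- s | ~~ p l], f; split.
  - exact: filter_uniq.
  - by move=> l; rewrite mem_filter => /andP[/asboolP].
  - by move=> l; rewrite mem_filter => /andP[_]; exact: es.
  - by rewrite /hB big_filter.
have wAh : ip w hA = 0.
  rewrite inner_sumr big_seq_cond big1// => l /andP[ls /asboolP Al].
  by apply: wA Al _; exact: es.
have hAB : ip hB hA = 0.
  rewrite inner_sumr big_seq_cond big1// => l /andP[ls pl].
  rewrite inner_suml big_seq_cond big1// => m /andP[ms pm].
  by apply: (eig_orth cT _ (es m ms) (es l ls)); apply: contraNneq pm => ->.
have NA : N hA <= N (w - \sum_(l <- s) f l).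
  have [->|A0] := eqVneq (N hA) 0; first exact: seminorm_ge0.
  have pA : 0 < N hA by rewrite lt_neqAle eq_sym A0 seminorm_ge0.
  rewrite -(ler_pM2r pA) -expr2 seminorm_sqr.
  apply: le_trans (cauchy_schwarz _ _ _).
  by rewrite hE innerBl innerDl wAh hAB addr0 sub0r normrN ler_norm.
have -> : w - hB = (w - \sum_(l <- s) f l) + hA.
  by rewrite hE opprD addrA addrAC subrK.
by rewrite (le_lt_trans (seminormD _ _ _))// (splitr e) ltrD// (le_lt_trans NA).
Qed.

(** Exact orthogonality passes to the closure as the angle bound with constant 0. *)
Lemma spectral_proj_orth A f g : spectral_proj T A f g -> ip g (f - g) = 0.
Proof.
move=> [gA fg]; apply/eqP; rewrite -normr_le0.
rewrite -(mul0r (N g * N (f - g))).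
apply: (@adherent_angle (span T A) [set f - g]) => //.
- by move=> x _ xA ->; rewrite mul0r innerC (eigenspan_orth fg xA) normr0.
- by move=> e e0; exists (f - g) => //; rewrite subrr seminorm0.
Qed.

Lemma spectral_proj_le A f g : spectral_proj T A f g -> N g <= N f /\ N (f - g) <= N f.
Proof.
move=> /spectral_proj_orth gfg.
have : ip f f = ip g g + ip (f - g) (f - g).
  by rewrite !innerBr innerC in gfg *; rewrite !innerBl (innerC ip g f) in gfg *; lra.
have := inner_ge0 ip g; have := inner_ge0 ip (f - g) => fg0 g0 E.
by split; rewrite ler_wsqrtr// E ?lerDl ?lerDr.
Qed.

End Complement.

(** Since each [gi] is orthogonal to [f - gi], the square norm of [g1 - g2] equals
    [ip g1 (f - g2) + ip g2 (f - g1)]. Each term pairs a vector of one operator's spectral subspace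
    over the interval with one of the other's over the complement, and the angle estimate bounds it
    by half of [eps ^+ 2]. *)
Theorem spectral_proj_continuous T (a b eps : R) : fast_complete ip ->
  compact_sa T -> a != 0 -> b != 0 -> non_eigenvalue ip T a ->
  non_eigenvalue ip T b -> 0 < eps ->
  exists2 eta, 0 < eta & forall S, compact_sa S ->
    (forall x, N (S x - T x) <= eta * N x) ->
    forall f g1 g2, N f <= 1 -> spectral_proj S `]a, b]%classic f g1 ->
      spectral_proj T `]a, b]%classic f g2 -> N (g1 - g2) <= eps.
Proof.
move=> compl cT a0 b0 na nb eps0.
have [ba|ab] := leP b a.
  exists 1 => // S cS _ f g1 g2 _.
  have -> : `]a, b]%classic = set0 :> set R.
    by rewrite set_itv_ge// bnd_simp -leNgt.
  suff null0 (U : {linear H -> H}) g : adherent ip (span U set0) g -> N g = 0.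
    move=> [/null0 g10 _] [/null0 g20 _]; rewrite (le_trans (seminormD _ _ _))//.
    by rewrite seminormN g10 g20 addr0 ltW.
  move=> gU; apply/eqP; rewrite eq_le seminorm_ge0 andbT.
  apply/ler_addgt0Pr => e /gU [_ [s [h [_ s0 _ ->]]]].
  case: s s0 => [|l s /(_ l (mem_head _ _))//].
  by rewrite big_nil subr0 add0r => _ /ltW.
have [da da0 daP] := non_eigenvalue_lower_bound cT compl a0 na.
have [db db0 dbP] := non_eigenvalue_lower_bound cT compl b0 nb.
(* Half of the lower bounds is kept as the gap [d]; the other half absorbs the perturbation, of size
   [eta <= d]. *)
pose d := Num.min da db / 2.
have d0 : 0 < d by rewrite divr_gt0 // lt_min da0 db0.
have [dda ddb] : 2 * d <= da /\ 2 * d <= db.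
  have -> : 2 * d = Num.min da db by rewrite /d; field.
  by rewrite !ge_min !lexx orbT.
(* In terms of the midpoint and half-length, eigenvalues in the interval satisfy [|l - c| <= r], and
   those outside, being at distance [d] from both endpoints, satisfy [|l - c| >= r + d]. *)
pose c := (a + b) / 2; pose r := (b - a) / 2.
have r0 : 0 <= r by rewrite /r; lra.
(* The first bound preserves the gap for [S]; the second makes the angle constant [eta / d] at most
   [eps ^+ 2 / 2]. *)
exists (Num.min d (d * eps ^+ 2 / 2)).
  by rewrite lt_min d0/= divr_gt0// mulr_gt0// exprn_gt0.
set eta := Num.min _ _ => S cS ST f g1 g2 f1 Sg1 Tg2.
have eta_d : eta <= d by rewrite ge_min lexx.
have eta_eps : eta <= d * eps ^+ 2 / 2 by rewrite ge_min lexx orbT.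
have eta0 : 0 <= eta by rewrite le_min (ltW d0)/= divr_ge0// mulr_ge0 ?sqr_ge0// ltW.
have TS x : N (T x - S x) <= eta * N x by rewrite seminormB.
(* On an eigenvector of [U] for [l], the operator [U - t] acts as [l - t], while it differs from
   [T - t], bounded below by [2 * d], by at most [eta <= d]. *)
have gapT t dt (U : {linear H -> H}) l v :
    (forall x, dt * N x <= N (T x - t *: x)) -> 2 * d <= dt ->
    (forall x, N (U x - T x) <= eta * N x) -> eig U l v -> d * N v <= `|l - t| * N v.
  move=> dtP ddt UT lv.
  have -> : `|l - t| * N v = N (U v - t *: v).
    have [_ _ eZ] := eig_subspace ip U l.
    rewrite -seminormZ -(@seminorm_null_add _ _ ip ((l - t) *: v) (U v - l *: v))//.
    by rewrite scalerBl addrC addrA subrK.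
  have := seminorm_dist ip (T v) (U v) (t *: v); rewrite (seminormB _ (T v) (U v)).
  have := dtP v; have := UT v; have := seminorm_ge0 ip v => h1 h2 h3 h4.
  have := ler_wpM2r h1 eta_d; have := ler_wpM2r h1 ddt; lra.
have TT x : N (T x - T x) <= eta * N x.
  by rewrite subrr seminorm0 mulr_ge0 ?seminorm_ge0.
have inA (U : {linear H -> H}) l v : `]a, b]%classic l -> eig U l v -> `|l - c| * N v <= r * N v.
  rewrite /= in_itv /= => /andP[al lb] _; rewrite ler_wpM2r ?seminorm_ge0//.
  by rewrite ler_norml /c /r; apply/andP; split; lra.
have outA (U : {linear H -> H}) l v : (forall x, N (U x - T x) <= eta * N x) ->
    (~` `]a, b]%classic) l -> eig U l v -> (r + d) * N v <= `|l - c| * N v.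
  move=> UT lA lv.
  have := gapT a da U l v daP dda UT lv; have := gapT b db U l v dbP ddb UT lv.
  have [->|v0] := eqVneq (N v) 0; first by rewrite !mulr0.
  have Nv : 0 < N v by rewrite lt_neqAle eq_sym v0 seminorm_ge0.
  rewrite !ler_pM2r// => lb la; move: lA; rewrite /= in_itv /= => /negP.
  rewrite negb_and -leNgt -ltNge => /orP[l_a|b_l].
    rewrite ler0_norm ?subr_le0// in la.
    by rewrite -normrN (le_trans _ (ler_norm _))// /c /r; lra.
  rewrite ger0_norm ?subr_ge0 ?(ltW b_l)// in lb.
  by rewrite (le_trans _ (ler_norm _))// /c /r; lra.
have k0 : 0 <= eta / d by rewrite divr_ge0 ?(ltW d0).
have ang1 := adherent_angle k0 (eigenspan_angle cS cT r0 d0 eta0 (inA S)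
  (fun l v => outA T l v TT) ST) Sg1.1 (eigenspan_compl compl cT Tg2.2).
have ang2 := adherent_angle k0 (eigenspan_angle cT cS r0 d0 eta0 (inA T)
  (fun l v => outA S l v ST) TS) Tg2.1 (eigenspan_compl compl cS Sg1.2).
have [Ng1 Nfg1] := spectral_proj_le Sg1; have [Ng2 Nfg2] := spectral_proj_le Tg2.
have small x y : `|ip x y| <= eta / d * (N x * N y) -> N x <= N f -> N y <= N f ->
    ip x y <= eps ^+ 2 / 2.
  move=> h xf yf; rewrite (le_trans (ler_norm _))// (le_trans h)//.
  apply: (@le_trans _ _ (eta / d * 1)).
    by rewrite ler_wpM2l// mulr_ile1 ?seminorm_ge0// (le_trans _ f1).
  by rewrite mulr1 ler_pdivrMr// mulrC mulrA.
have s1 := small _ _ ang1 Ng1 Nfg2; have s2 := small _ _ ang2 Ng2 Nfg1.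
rewrite -ler_sqr ?nnegrE ?seminorm_ge0 ?(ltW eps0)// seminorm_sqr.
have := spectral_proj_orth Sg1; have := spectral_proj_orth Tg2.
have := innerC ip g2 g1.
rewrite !(innerBr, innerBl) in s1 s2 *; lra.
Qed.

End Angle.

(** * Integration and square-integrable functions on the unit interval *)

Section UnitInterval.
Context {R : realType}.
Local Notation leb := (@lebesgue_measure R).
Local Notation I := (@I01 R).
Local Notation integ f := (leb.-integrable I (EFin \o f)).
(* [R] carries its Borel sets under two displays, and [lebesgue_measure] lives
   on [measurableTypeR R]; the two notions of measurability are convertible. *)
Local Notation mfun f := (@measurable_fun _ _ (measurableTypeR R) R I f).
Implicit Types (f g h : R -> R) (M : R).

Lemma measurable_I01 : @measurable _ (measurableTypeR R) I.
Proof. exact: measurable_itv. Qed.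
#[local] Hint Resolve measurable_I01 : core.

Lemma lebesgue_I01 : leb I = 1%E.
Proof. by rewrite /I01 lebesgue_measure_itv/= lte_fin ltr01 oppr0 adde0. Qed.

Lemma integ_bounded f M : mfun f -> (forall x, I x -> `|f x| <= M) -> integ f.
Proof.
move=> mf fM; apply: measurable_bounded_integrable => //.
  by rewrite [X in (X < _)%E]lebesgue_I01 ltry.
exists M; split; first exact: num_real.
by move=> N MN x Ix /=; rewrite (le_trans (fM x Ix))// ltW.
Qed.

Lemma integ_le f g : mfun f -> integ g ->
  (forall x, I x -> `|f x| <= `|g x|) -> integ f.
Proof.
move=> mf ig fg; apply: le_integrable ig => //; exact/measurable_EFinP.
Qed.

Lemma integ_measurable f : integ f -> mfun f.
Proof. by move=> /measurable_int /measurable_EFinP. Qed.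

Lemma integD f g : integ f -> integ g -> integ (fun x => f x + g x).
Proof. by move=> fi gi; exact: (integrableD measurable_I01 fi gi). Qed.

Lemma integZ a f : integ f -> integ (fun x => a * f x).
Proof. by move=> fi; exact: (integrableZl measurable_I01 a fi). Qed.

Lemma integ_norm f : integ f -> integ (fun x => `|f x|).
Proof.
move=> fi; apply: (integ_le _ fi) => [|x _]; last by rewrite normr_id.
exact: measurableT_comp (integ_measurable fi).
Qed.

Lemma int01_EFin f : integ f -> (int01 f)%:E = (\int[leb]_(x in I) (f x)%:E)%E.
Proof. by move=> fi; rewrite /int01 /Rintegral fineK//; exact: integrable_fin_num. Qed.

Lemma eq_int01 f g : (forall x, I x -> f x = g x) -> int01 f = int01 g.
Proof. by move=> fg; apply: eq_Rintegral => x /set_mem /fg. Qed.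

Lemma int01D f g : integ f -> integ g -> int01 (fun x => f x + g x) = int01 f + int01 g.
Proof. exact: RintegralD. Qed.

Lemma int01B f g : integ f -> integ g -> int01 (fun x => f x - g x) = int01 f - int01 g.
Proof. exact: RintegralB. Qed.

Lemma int01Z a f : integ f -> int01 (fun x => a * f x) = a * int01 f.
Proof. exact: RintegralZl. Qed.

Lemma le_int01 f g : integ f -> integ g -> (forall x, I x -> f x <= g x) ->
  int01 f <= int01 g.
Proof. exact: le_Rintegral. Qed.

Lemma int01_ge0 f : (forall x, I x -> 0 <= f x) -> 0 <= int01 f.
Proof. by move=> f0; rewrite /int01; apply: Rintegral_ge0. Qed.

Lemma le_norm_int01 f : integ f -> `|int01 f| <= int01 (fun x => `|f x|).
Proof. by move=> fi; rewrite /int01; apply: le_normr_Rintegral. Qed.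

Lemma int01_cst (a : R) : int01 (fun=> a) = a.
Proof. by rewrite /int01 Rintegral_cst// [X in fine X]lebesgue_I01 mulr1. Qed.

Lemma norm_int01_le f M : mfun f -> (forall x, I x -> `|f x| <= M) ->
  `|int01 f| <= M.
Proof.
move=> mf fM; have fi := integ_bounded mf fM.
rewrite (le_trans (le_norm_int01 fi))// -[leRHS](int01_cst M).
apply: le_int01 => //; first exact: integ_norm.
by apply: (@integ_bounded _ `|M|).
Qed.

Lemma L2_mfun f : L2 f -> mfun f.
Proof. by case. Qed.

Lemma L2_intro f : mfun f -> integ (fun x => f x ^+ 2) -> L2 f.
Proof. by []. Qed.

Lemma L2_mul f g : L2 f -> L2 g -> integ (fun x => f x * g x).
Proof.
move=> L2f L2g; have [[_ f2] [_ g2]] := (L2f, L2g).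
apply: (integ_le _ (integD f2 g2)); first exact: measurable_funM (L2_mfun L2f) (L2_mfun L2g).
move=> x _; rewrite [leRHS]ger0_norm ?addr_ge0 ?sqr_ge0// normrM.
rewrite -(real_normK (num_real (f x))) -(real_normK (num_real (g x))).
by have := sqr_ge0 (`|f x| - `|g x|); have := sqr_ge0 (`|f x|); have := sqr_ge0 (`|g x|); nra.
Qed.

Lemma L2_bounded f M : mfun f -> (forall x, I x -> `|f x| <= M) -> L2 f.
Proof.
move=> mf fM; apply: L2_intro => //; apply: (@integ_bounded (fun x => f x ^+ 2) (M ^+ 2)).
  exact: measurable_funX.
move=> x Ix; rewrite normrX ler_sqr ?nnegrE ?normr_ge0 ?fM//.
by rewrite (le_trans _ (fM x Ix)).
Qed.

Lemma L2_cst (a : R) : L2 (fun=> a).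
Proof. exact: (@L2_bounded _ `|a|). Qed.

Lemma L2_integ f : L2 f -> integ f.
Proof.
move=> f2; have := L2_mul f2 (L2_cst 1).
by apply: eq_integrable => // x _; rewrite /= mulr1.
Qed.

Lemma L2_add f g : L2 f -> L2 g -> L2 (fun x => f x + g x).
Proof.
move=> f2 g2; apply: L2_intro; first exact: measurable_funD (L2_mfun f2) (L2_mfun g2).
have := integD (integD f2.2 (integZ 2 (L2_mul f2 g2))) g2.2.
apply: eq_integrable => // x _ /=; congr EFin; ring.
Qed.

Lemma L2_scale a f : L2 f -> L2 (fun x => a * f x).
Proof.
move=> f2; apply: L2_intro; first exact: measurable_funM (L2_mfun f2).
have := integZ (a ^+ 2) f2.2.
by apply: eq_integrable => // x _ /=; rewrite exprMn.
Qed.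

Lemma L2_sub f g : L2 f -> L2 g -> L2 (fun x => f x - g x).
Proof.
move=> f2 g2; have -> : (fun x => f x - g x) = (fun x => f x + -1 * g x).
  by apply/funext => x; rewrite mulN1r.
exact: L2_add f2 (L2_scale _ g2).
Qed.

Lemma eq_L2 f g : (forall x, I x -> f x = g x) -> L2 f -> L2 g.
Proof.
move=> fg L2f; apply: L2_intro.
  by apply: eq_measurable_fun (L2_mfun L2f) => x /set_mem /fg.
have [_ f2] := L2f.
by apply: eq_integrable f2 => // x /set_mem /fg /= ->.
Qed.

Lemma eq_ip f f' g g' : (forall x, I x -> f x = f' x) -> (forall x, I x -> g x = g' x) ->
  ip f g = ip f' g'.
Proof. by move=> ff gg; apply: eq_int01 => x Ix; rewrite ff// gg. Qed.

End UnitInterval.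
#[export] Hint Resolve measurable_I01 : core.

(** * The semi-inner product space of square-integrable functions *)

Section L2Space.
Context {R : realType}.
Local Notation leb := (@lebesgue_measure R).
Local Notation I := (@I01 R).

Definition L2pred : {pred R -> R} := fun f => `[< L2 f >].

Lemma L2pred_submod_closed : submod_closed L2pred.
Proof.
split; first by apply/asboolP; exact: L2_cst.
move=> a f g /asboolP f2 /asboolP g2; apply/asboolP.
exact: L2_add (L2_scale a f2) g2.
Qed.

HB.instance Definition _ := GRing.isSubmodClosed.Build R (R -> R) L2pred
  L2pred_submod_closed.

Record L2space := L2Space { L2fun :> R -> R; L2fun_pred : L2fun \in L2pred }.

HB.instance Definition _ := [isSub for L2fun].
HB.instance Definition _ := gen_eqMixin L2space.
HB.instance Definition _ := gen_choiceMixin L2space.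
HB.instance Definition _ := [SubChoice_isSubLmodule of L2space by <:].

Lemma L2funP (f : L2space) : L2 f.
Proof. by apply/asboolP; exact: (L2fun_pred f). Qed.

Definition toL2 f (f2 : L2 f) : L2space := L2Space (asboolT f2).

Lemma L2funD (f g : L2space) x : (f + g) x = f x + g x. Proof. by []. Qed.
Lemma L2funB (f g : L2space) x : (f - g) x = f x - g x. Proof. by []. Qed.
Lemma L2funZ a (f : L2space) x : (a *: f) x = a * f x. Proof. by []. Qed.

Lemma ip_comm (f g : R -> R) : ip f g = ip g f.
Proof. by apply: eq_int01 => x _; rewrite mulrC. Qed.

Lemma ip_addl (f g h : L2space) : ip (f + g) h = ip f h + ip g h.
Proof.
rewrite /ip -int01D; [|exact: L2_mul (L2funP _) (L2funP _)..].
by apply: eq_int01 => x _; rewrite L2funD mulrDl.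
Qed.

Lemma ip_scalel a (f g : L2space) : ip (a *: f) g = a * ip f g.
Proof.
rewrite /ip -int01Z; last exact: L2_mul (L2funP _) (L2funP _).
by apply: eq_int01 => x _; rewrite L2funZ mulrA.
Qed.

Lemma ip_self_ge0 (f : L2space) : 0 <= ip f f.
Proof. by apply: int01_ge0 => x _; rewrite -expr2 sqr_ge0. Qed.

Definition L2ip : semi_inner L2space :=
  SemiInner (fun f g : L2space => ip_comm f g) ip_addl ip_scalel ip_self_ge0.

End L2Space.
Arguments L2space : clear implicits.
Arguments L2ip : clear implicits.

(** * Completeness of L^2 *)

Section RieszFischer.
Context {R : realType}.
Local Notation leb := (@lebesgue_measure R).
Local Notation I := (@I01 R).
Local Notation mfun f := (@measurable_fun _ _ (measurableTypeR R) R I f).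
Local Notation N := (seminorm (L2ip R)).
Implicit Types (f g : R -> R).

Lemma L2_norm f : L2 f -> L2 (fun x => `|f x|).
Proof.
move=> L2f; apply: L2_intro; first exact: measurableT_comp (L2_mfun L2f).
have [_ f2] := L2f; apply: eq_integrable f2 => // x _ /=.
by rewrite real_normK ?num_real.
Qed.

(** Cauchy-Schwarz against the constant 1, which has norm 1. *)
Lemma int01_norm_le f : L2 f -> int01 (fun x => `|f x|) <= norm2 f.
Proof.
move=> L2f; pose F := toL2 (L2_norm L2f); pose U := toL2 (@L2_cst R 1).
have := le_trans (ler_norm _) (cauchy_schwarz (L2ip R) F U).
have -> : N U = 1.
  rewrite /seminorm /= /ip -[RHS]sqrtr1; congr Num.sqrt.
  by rewrite -[RHS](@int01_cst R); apply: eq_int01 => x _; rewrite /= mulr1.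
have -> : N F = norm2 f.
  rewrite /seminorm /= /norm2 /ip; congr Num.sqrt.
  by apply: eq_int01 => x _; rewrite /= -normrM ger0_norm// -expr2 sqr_ge0.
rewrite mulr1; congr (_ <= _).
by apply: eq_int01 => x _; rewrite /= mulr1.
Qed.

Lemma limn_einf_le (u : (\bar R)^nat) (c : \bar R) n0 :
  (forall n, (n0 <= n)%N -> (u n <= c)%E) -> (limn_einf u <= c)%E.
Proof.
move=> uc; rewrite limn_einf_lim; apply: lime_le; first exact: is_cvg_einfs.
exists n0 => // n /= n0n; apply: le_trans (uc n n0n).
by apply: ereal_inf_lbound; exists n => /=.
Qed.

Lemma measurable_fun_limn_einf (f : (R -> \bar R)^nat) :
  (forall n, @measurable_fun _ _ (measurableTypeR R) (\bar R) I (f n)) ->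
  @measurable_fun _ _ (measurableTypeR R) (\bar R) I (fun x => limn_einf (f ^~ x)).
Proof.
move=> mf; have -> : (fun x => limn_einf (f ^~ x)) =
    (fun x => - limn_esup (fun n => - f n x))%E.
  by apply/funext => x; rewrite -limn_einfN; congr limn_einf; apply/funext => n /=; rewrite oppeK.
apply: measurableT_comp => //; apply: measurable_fun_limn_esup => n.
exact: measurableT_comp (mf n).
Qed.

Section CauchySequence.
Variable u : nat -> L2space R.
Hypothesis cu : fast_cauchy (L2ip R) u.

Let v k x := u k.+1 x - u k x.

Let L2v k : L2 (v k).
Proof. exact: L2_sub (L2funP _) (L2funP _). Qed.

Let int_v k : (\int[leb]_(x in I) `|v k x|%:E <= (2^-1 ^+ k)%:E)%E.
Proof.
rewrite -int01_EFin; last exact: L2_integ (L2_norm (L2v k)).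
rewrite lee_fin (le_trans (int01_norm_le (L2v k)))//.
have -> : norm2 (v k) = N (u k.+1 - u k) by [].
by rewrite seminormB cu.
Qed.

(** By monotone convergence the series of the [|v k|] has integral at most the geometric sum 2. It
    is therefore finite almost everywhere, and the telescoping series of the [v k] converges
    absolutely there. *)
Let ae_cvg_u : {ae leb, forall x, I x -> cvgn (fun n => u n x)}.
Proof.
pose G x := (\sum_(k <oo) `|v k x|%:E)%E.
have mv k : @measurable_fun _ _ (measurableTypeR R) (\bar R) I (fun x => `|v k x|%:E).
  by apply/measurable_EFinP; exact: L2_mfun (L2_norm (L2v k)).
have iG : (\int[leb]_(x in I) G x <= 2%:E)%E.
  rewrite integral_nneseries//.
  apply: lime_le; first by apply: is_cvg_nneseries => k _ _; exact: integral_ge0.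
  apply: nearW => n; apply: (@le_trans _ _ (\sum_(0 <= k < n) (2^-1 ^+ k)%:E)%E).
    by apply: lee_sum => k _; exact: int_v.
  rewrite sumEFin lee_fin.
  have := @geometric_le_lim R n 1 2^-1 ler01.
  rewrite seriesEnat /geometric /=; under eq_bigr do rewrite mul1r.
  have -> : 1 * (1 - 2^-1)^-1 = 2 :> R by field.
  by apply; rewrite ?ger0_norm; lra.
have : leb.-integrable I G.
  apply/integrableP; split.
    by apply: ge0_emeasurable_sum => // k x _ _; rewrite lee_fin.
  apply: le_lt_trans (ltry 2); apply: le_trans iG.
  rewrite le_eqVlt; apply/orP; left; apply/eqP; apply: eq_integral => x _.
  by rewrite gee0_abs// nneseries_ge0.
move=> /(integrable_ae (@measurable_I01 R)); apply: filterS => x Gx Ix.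
have vcvg : cvgn (series (fun k => v k x)).
  apply: normed_cvg; apply: nondecreasing_is_cvgn.
    by apply/nondecreasing_seqP => n; rewrite /= seriesEnat /= big_nat_recr//= lerDl.
  exists (fine (G x)) => _ [n _ <-]; rewrite -lee_fin fineK ?Gx//.
  rewrite /= seriesEnat -sumEFin; exact: nneseries_lim_ge.
have -> : (fun n => u n x) = (fun n => u 0%N x + series (fun k => v k x) n).
  apply/funext => n; rewrite seriesEnat /= /v telescope_sumr//.
  by rewrite addrC subrK.
by apply: is_cvgD vcvg; exact: is_cvg_cst.
Qed.

Lemma fast_cauchy_L2_cvg : exists x, (fun n => N (u n - x)) @ \oo --> (0 : R).
Proof.
(* The limit superior is measurable whether or not the sequence converges and equals the pointwise
   limit almost everywhere; [fine] sends infinite values to 0. *)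
pose g x := fine (limn_esup (fun n => (u n x)%:E)).
have mu_ n : mfun (u n) by exact: L2_mfun (L2funP _).
have mg : mfun g.
  apply: measurableT_comp => //; apply: measurable_fun_limn_esup => n.
  exact/measurable_EFinP.
have ug : {ae leb, forall x, I x -> u n x @[n --> \oo] --> g x}.
  have := ae_cvg_u; apply: (@filterS _ _ (ae_filter_ringOfSetsType leb)) => x ux Ix.
  have cux := ux Ix.
  have : (fun n => (u n x)%:E) @ \oo --> (limn (fun n => u n x))%:E.
    by apply: cvg_EFin => //; exact: nearW.
  by move=> /cvg_limn_einf_sup[_]; rewrite /g => ->.
(* Fatou's lemma in [m], applied to the squares of [u n - u m]. *)
have bound n : (\int[leb]_(x in I) ((u n x - g x) ^+ 2)%:E <= ((2^-1 ^+ n) ^+ 2)%:E)%E.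
  pose F m x := ((u n x - u m x) ^+ 2)%:E.
  have mF m : @measurable_fun _ _ (measurableTypeR R) (\bar R) I (F m).
    by apply/measurable_EFinP; apply: measurable_funX; exact: measurable_funB.
  have -> : (\int[leb]_(x in I) ((u n x - g x) ^+ 2)%:E =
      \int[leb]_(x in I) limn_einf (F ^~ x))%E.
    apply: ae_eq_integral => //.
    - by apply/measurable_EFinP; apply: measurable_funX; exact: measurable_funB.
    - exact: measurable_fun_limn_einf.
    move: ug; apply: (@filterS _ _ (ae_filter_ringOfSetsType leb)) => x ugx Ix.
    have ux := ugx Ix.
    have : (fun m => F m x) @ \oo --> ((u n x - g x) ^+ 2)%:E.
      apply: cvg_EFin; first exact: nearW.
      apply: (@continuous_cvg _ _ _ _ _ _ (fun t : R => t ^+ 2)).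
        exact: exprn_continuous.
      by apply: cvgB => //; exact: cvg_cst.
    by move=> /cvg_limn_einf_sup[-> _].
  apply: le_trans (fatou _ _ _ _) _ => //.
    by move=> m x _; rewrite lee_fin sqr_ge0.
  apply: (@limn_einf_le _ _ n) => m nm.
  have L2nm : L2 (fun x => u n x - u m x) by exact: L2_sub (L2funP _) (L2funP _).
  rewrite /F -int01_EFin; last exact: L2nm.2.
  rewrite lee_fin.
  have : N (u n - u m) ^+ 2 <= (2^-1 ^+ n) ^+ 2.
    by rewrite ler_sqr ?nnegrE ?seminorm_ge0 ?exprn_ge0 ?invr_ge0// cu.
  by rewrite seminorm_sqr.
have L2ng n : L2 (fun x => u n x - g x).
  apply: L2_intro; first exact: measurable_funB.
  apply/integrableP; split.
    by apply/measurable_EFinP; apply: measurable_funX; exact: measurable_funB.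
  apply: le_lt_trans (ltry ((2^-1 ^+ n) ^+ 2)); apply: le_trans (bound n).
  rewrite le_eqVlt; apply/orP; left; apply/eqP; apply: eq_integral => x _ /=.
  by rewrite ger0_norm// sqr_ge0.
have L2g : L2 g.
  apply: eq_L2 (L2_sub (L2funP (u 0%N)) (L2ng 0%N)) => x _ /=.
  by rewrite opprB addrC subrK.
exists (toL2 L2g); apply: (@cvg0_le _ 1) (@cvg_half_exp R) => // n.
rewrite mul1r ger0_norm ?seminorm_ge0// ger0_norm ?exprn_ge0 ?invr_ge0//.
rewrite -ler_sqr ?nnegrE ?seminorm_ge0 ?exprn_ge0 ?invr_ge0// seminorm_sqr.
by rewrite -lee_fin (int01_EFin (L2ng n).2) bound.
Qed.

End CauchySequence.

Theorem L2_complete : fast_complete (L2ip R).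
Proof. by move=> u; exact: fast_cauchy_L2_cvg. Qed.

End RieszFischer.

(** * Integral operators and the cut norm *)

Section KernelOperator.
Context {R : realType}.
Local Notation mR := (measurableTypeR R).
Local Notation leb := (@lebesgue_measure R).
Local Notation I := (@I01 R).
Local Notation mfun f := (@measurable_fun _ _ mR R I f).
Local Notation integ f := (leb.-integrable I (EFin \o f)).
Local Notation N := (seminorm (L2ip R)).
Implicit Types (f g : R -> R) (U : R -> R -> R).

(** Covers graphons and differences of two graphons alike, so one operator theory serves for [K_W]
    and for the error term. *)
Definition bounded_kernel U :=
  [/\ @measurable_fun _ _ (mR * mR)%type R setT (fun p => U p.1 p.2),
      (forall x y, I x -> I y -> U x y = U y x) &
      forall x y, I x -> I y -> `|U x y| <= 1].

Lemma I01_patch f x : I x -> (f \_ I) x = f x.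
Proof. by move=> Ix; rewrite patchT// inE. Qed.

Lemma I01_patch0 f x : ~ I x -> (f \_ I) x = 0.
Proof. by move=> Ix; rewrite patchC// inE. Qed.

Section OneKernel.
Context (U : R -> R -> R) (bU : bounded_kernel U).

Lemma kernel_section x : mfun (U x).
Proof.
have [mU _ _] := bU; apply: measurable_funTS.
exact: (measurableT_comp mU (@pair1_measurable _ _ mR mR x)).
Qed.

Lemma kernel_mul_integ x f : I x -> integ f -> integ (fun y => U x y * f y).
Proof.
move=> Ix fi; have [_ _ U1] := bU; apply: (integ_le _ fi).
  exact: measurable_funM (kernel_section x) (integ_measurable fi).
by move=> y Iy; rewrite normrM ler_piMl// U1.
Qed.

Lemma norm_K_le_int x f : I x -> integ f -> `|K U f x| <= int01 (fun y => `|f y|).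
Proof.
move=> Ix fi; have [_ _ U1] := bU.
rewrite (le_trans (le_norm_int01 (kernel_mul_integ Ix fi)))//.
apply: le_int01; [exact: integ_norm (kernel_mul_integ Ix fi)|exact: integ_norm|].
by move=> y Iy; rewrite normrM ler_piMl// U1.
Qed.

Lemma norm_K_le x f : I x -> L2 f -> `|K U f x| <= norm2 f.
Proof.
move=> Ix f2; apply: le_trans (int01_norm_le f2).
exact: norm_K_le_int (L2_integ f2).
Qed.

(** The integrand of [ip (K U f) g], cut off outside the unit square so that Fubini's theorem
    applies on the whole plane. *)
Let F f g (p : mR * mR) : R := U p.1 p.2 * (f \_ I) p.2 * (g \_ I) p.1.

Let mF f g : mfun f -> mfun g -> measurable_fun setT (F f g).
Proof.
move=> mf mg; have [mU _ _] := bU.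
apply: measurable_funM; first apply: measurable_funM => //.
- have mf' := (measurable_restrictT f (@measurable_I01 R)).1 mf.
  exact: (measurableT_comp mf' (@measurable_snd _ _ mR mR)).
- have mg' := (measurable_restrictT g (@measurable_I01 R)).1 mg.
  exact: (measurableT_comp mg' (@measurable_fst _ _ mR mR)).
Qed.

Let F_section f g x : I x -> (fun y => F f g (x, y)) = (fun y => g x * (U x y * f y)) \_ I.
Proof.
move=> Ix; apply/funext => y; have [Iy|Iy] := pselect (I y).
  by rewrite /F /= !I01_patch// mulrC.
by rewrite /F /= !(@I01_patch0 _ y)// mulr0 mul0r.
Qed.

Let int_F_section f g x : I x -> integ f ->
  (\int[leb]_y (F f g (x, y))%:E)%E = (K U f x * g x)%:E.
Proof.
move=> Ix fi; rewrite mulrC /K -int01Z; last exact: kernel_mul_integ.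
rewrite int01_EFin; last exact: integZ (kernel_mul_integ Ix fi).
rewrite [RHS]integral_mkcond; apply: eq_integral => y _.
by rewrite -[F f g (x, y)]/((fun y => F f g (x, y)) y) F_section// !patchE; case: ifP.
Qed.

Let int_F_section_out f g x : ~ I x -> (\int[leb]_y (F f g (x, y))%:E)%E = 0%E.
Proof.
by move=> Ix; apply: integral0_eq => y _; rewrite /F /= (I01_patch0 g Ix) mulr0.
Qed.

Let F_integrable f g : integ f -> integ g -> (leb \x leb)%E.-integrable setT (EFin \o F f g).
Proof.
move=> fi gi; have [_ _ U1] := bU.
apply/integrable12ltyP.
  by apply/measurable_EFinP; apply: mF; exact: integ_measurable.
pose c := (\int[leb]_(y in I) `|f y|%:E)%E.
have cE : c = (int01 (fun y => `|f y|))%:E by rewrite int01_EFin//; exact: integ_norm.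
apply: (@le_lt_trans _ _ (\int[leb]_x (c * (`|(g \_ I) x|)%:E))%E).
  apply: ge0_le_integral => //.
  - by move=> x _; exact: integral_ge0.
  - apply: (@measurable_fun_fubini_tonelli_F _ _ mR mR R leb (abse \o (EFin \o F f g))) => //.
      apply: measurableT_comp => //; apply/measurable_EFinP; apply: mF; exact: integ_measurable.
    by move=> p; exact: abse_ge0.
  - rewrite cE; apply/measurable_EFinP; apply: measurable_funM => //.
    apply: measurableT_comp => //.
    by apply/(measurable_restrictT _ (@measurable_I01 R)); exact: integ_measurable.
  - move=> x _; have [Ix|Ix] := pselect (I x); last first.
      rewrite I01_patch0// normr0 mule0 integral0_eq// => y _.
      by rewrite /F /= (I01_patch0 g Ix) mulr0 normr0.
    have gfi : integ (fun y => g x * (U x y * f y)).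
      exact: integZ (kernel_mul_integ Ix fi).
    rewrite (_ : (\int[leb]_y _)%E = (\int[leb]_(y in I) `|g x * (U x y * f y)|%:E)%E).
      rewrite -int01_EFin; last exact: integ_norm.
      rewrite cE -EFinM lee_fin mulrC I01_patch//.
      rewrite -int01Z; last exact: integ_norm.
      apply: le_int01; [exact: integ_norm|exact: integZ (integ_norm fi)|].
      move=> y Iy; rewrite !normrM ler_wpM2l// ler_piMl// U1//.
    rewrite [RHS]integral_mkcond; apply: eq_integral => y _.
    have /= -> := congr1 (fun h => h y) (F_section f g Ix).
    have [Iy|Iy] := pselect (I y); first by rewrite /= !patchT ?inE.
    by rewrite /= !patchC ?inE//= normr0.
rewrite cE.
rewrite (_ : (\int[leb]_x _)%E =
  (\int[leb]_(x in I) ((int01 (fun y => `|f y|))%:E * `|g x|%:E))%E).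
  rewrite -(int01_EFin (integZ _ (integ_norm gi))); exact: ltry.
rewrite [RHS]integral_mkcond; apply: eq_integral => x _.
have [Ix|Ix] := pselect (I x); first by rewrite !patchT ?inE.
by rewrite !patchC ?inE// normr0 mule0.
Qed.

(** With [g = 1] in [F], Fubini's theorem gives measurability of the partial integral. *)
Lemma measurable_K f : integ f -> mfun (K U f).
Proof.
move=> fi; have i1 : integ (fun=> 1) by apply: (@integ_bounded _ _ 1) => // x _; rewrite normr1.
have mFF := measurable_fubini_F (F_integrable fi i1).
have mfF : measurable_fun I (fun x : mR => fine (\int[leb]_y (F f (fun=> 1) (x, y))%:E)%E).
  by apply: measurable_funTS; apply: measurableT_comp mFF.
apply: eq_measurable_fun mfF => x /set_mem Ix.
by rewrite int_F_section//= mulr1.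
Qed.

Lemma L2_K f : L2 f -> L2 (K U f).
Proof.
move=> f2; apply: (@L2_bounded _ _ (norm2 f)).
  exact: measurable_K (L2_integ f2).
by move=> x Ix; exact: norm_K_le.
Qed.

Let ip_K_fubini f g : L2 f -> L2 g ->
  (\int[leb]_x \int[leb]_y (F f g (x, y))%:E)%E = (ip (K U f) g)%:E.
Proof.
move=> f2 g2; rewrite int01_EFin; last exact: L2_mul (L2_K f2) g2.
rewrite [RHS]integral_mkcond; apply: eq_integral => x _.
have [Ix|Ix] := pselect (I x).
  by rewrite patchT ?inE// int_F_section//; exact: L2_integ.
by rewrite patchC ?inE// int_F_section_out.
Qed.

Lemma ip_K_sym f g : L2 f -> L2 g -> ip (K U f) g = ip f (K U g).
Proof.
move=> f2 g2; have [_ Usym _] := bU; apply: EFin_inj.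
rewrite (ip_comm f) -!ip_K_fubini//.
rewrite (Fubini (F_integrable (L2_integ f2) (L2_integ g2))).
apply: eq_integral => y _; apply: eq_integral => x _ /=; congr EFin.
rewrite /F /=; have [Ix|Ix] := pselect (I x); last by rewrite !(I01_patch0 _ Ix) !(mulr0, mul0r).
have [Iy|Iy] := pselect (I y); last by rewrite !(I01_patch0 _ Iy) !(mulr0, mul0r).
by rewrite Usym// mulrAC.
Qed.

(* [K U f] is only controlled on [[0, 1]], hence the truncation. *)
Definition kop_fun (f : L2space R) := K U f \_ I.

Lemma L2_kop (f : L2space R) : L2 (kop_fun f).
Proof.
apply: eq_L2 (L2_K (L2funP f)) => x Ix.
by rewrite /kop_fun I01_patch.
Qed.

Definition kop (f : L2space R) : L2space R := toL2 (L2_kop f).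

Lemma kopE (f : L2space R) x : I x -> kop f x = K U f x.
Proof. by move=> Ix; rewrite /kop /= /kop_fun I01_patch. Qed.

Lemma kop_linear : linear kop.
Proof.
move=> a /= f g; apply: val_inj; apply/funext => x.
rewrite -[LHS]/(kop_fun _ x) -[RHS]/(a * kop_fun f x + kop_fun g x) /kop_fun.
have [Ix|Ix] := pselect (I x); last by rewrite !(I01_patch0 _ Ix) mulr0 addr0.
rewrite !I01_patch// /K -int01Z; last exact: kernel_mul_integ Ix (L2_integ (L2funP _)).
rewrite -int01D; last 2 first.
- exact: integZ (kernel_mul_integ Ix (L2_integ (L2funP _))).
- exact: kernel_mul_integ Ix (L2_integ (L2funP _)).
by apply: eq_int01 => y _; rewrite L2funD L2funZ; ring.
Qed.

End OneKernel.

HB.instance Definition _ U (bU : bounded_kernel U) :=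
  GRing.isLinear.Build R (L2space R) (L2space R) _ (kop bU) (kop_linear bU).

Section OneKernel2.
Context (U : R -> R -> R) (bU : bounded_kernel U).

Lemma ip_kop (f g : L2space R) : ip (kop bU f) g = ip (K U f) g.
Proof. by apply: eq_ip => // x Ix; rewrite kopE. Qed.

Lemma norm_kop_le (f : L2space R) x : I x -> `|kop bU f x| <= N f.
Proof. by move=> Ix; rewrite kopE//; exact: norm_K_le (L2funP f). Qed.

(** Contraction follows from the pointwise bound by [N f] on an interval of length 1. For
    compactness, the value of the image of [u n] at [x] is the inner product of [u n] with the
    section [U x], so weak nullity gives pointwise convergence to 0; the images are bounded by 1 and
    dominated convergence concludes. *)
Lemma kop_compact_selfadjoint : compact_selfadjoint (L2ip R) (kop bU).
Proof.
split.
- move=> f g; rewrite /= ip_kop (ip_comm f) ip_kop (ip_comm _ f).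
  exact: ip_K_sym (L2funP f) (L2funP g).
- move=> f; rewrite -ler_sqr ?nnegrE ?seminorm_ge0// [leLHS]seminorm_sqr.
  rewrite -[leRHS](@int01_cst R); apply: le_int01.
  + exact: L2_mul (L2funP _) (L2funP _).
  + by apply: (@integ_bounded _ _ (N f ^+ 2)) => // x _; rewrite ger0_norm ?sqr_ge0.
  + move=> x Ix; rewrite -expr2 -(real_normK (num_real (kop bU f x))).
    by rewrite ler_sqr ?nnegrE ?seminorm_ge0// norm_kop_le.
- move=> u u1 uweak.
  have ptw x : I x -> (fun n => kop bU (u n) x) @ \oo --> (0 : R).
    move=> Ix; have L2U : L2 (U x).
      have [_ _ U1] := bU; apply: (@L2_bounded _ _ 1); first exact: kernel_section.
      by move=> y Iy; exact: U1.
    have := uweak (toL2 L2U); apply: cvg_trans; apply: near_eq_cvg.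
    by apply: nearW => n; rewrite kopE//= (ip_comm (u n)).
  have sq0 : (fun n => (ip (kop bU (u n)) (kop bU (u n)))%:E) @ \oo --> 0%E.
    have := @dominated_cvg _ mR R leb I (@measurable_I01 R)
      (fun n x => (kop bU (u n) x * kop bU (u n) x)%:E) (cst 0%E) (cst 1%E).
    rewrite integral0 => dc; under eq_fun do rewrite (int01_EFin (L2_mul (L2funP _) (L2funP _))).
    apply: dc => //.
    + move=> n; apply/measurable_EFinP; apply: measurable_funM; exact: L2_mfun (L2funP _).
    + move=> x Ix; apply: cvg_EFin; first exact: nearW.
      by rewrite -[X in _ --> X](mulr0 0); apply: cvgM; exact: ptw.
    + by apply: (@integ_bounded _ (fun=> 1) 1) => // x _; rewrite normr1.
    + move=> n x Ix; rewrite lee_fin normrM mulr_ile1//;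
      by rewrite (le_trans (norm_kop_le _ Ix)).
  have {}sq0 : (fun n => ip (kop bU (u n)) (kop bU (u n))) @ \oo --> (0 : R).
    exact: (fine_cvg sq0).
  apply: cvg0_intro => e e0; have [n0 n0P] := cvg0_lt sq0 (exprn_gt0 2 e0).
  exists n0 => n /n0P; rewrite ger0_norm ?ip_self_ge0// ger0_norm ?seminorm_ge0//.
  by rewrite -[ltLHS]/(L2ip R _ _) -seminorm_sqr ltr_sqr ?nnegrE ?seminorm_ge0 ?ltW.
Qed.

Lemma int01_cut f g : mfun f -> mfun g -> (forall x, I x -> `|f x| <= 1) ->
  (forall x, I x -> `|g x| <= 1) ->
  int01 (fun x => int01 (fun y => f x * U x y * g y)) = ip (K U g) f.
Proof.
move=> mf mg f1 g1; apply: eq_int01 => x Ix; rewrite mulrC /K -int01Z.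
  by apply: eq_int01 => y Iy; rewrite mulrA.
exact: kernel_mul_integ Ix (integ_bounded mg g1).
Qed.

(** A [sup] dominates its set only if the set is bounded above; the bound 1 comes from [|U| <= 1]
    and the bounds on the test functions. *)
Lemma ip_le_cutnorm f g : mfun f -> mfun g -> (forall x, I x -> `|f x| <= 1) ->
  (forall x, I x -> `|g x| <= 1) -> `|ip (K U g) f| <= cutnorm U.
Proof.
move=> mf mg f1 g1; rewrite -int01_cut//; apply: ub_le_sup; last first.
  by exists f, g; repeat split => //; move=> x Ix; rewrite -ler_norml; [exact: f1|exact: g1].
exists 1 => _ [f' [g' [mf' [mg' [f'1 [g'1 ->]]]]]].
have {}f'1 x : I x -> `|f' x| <= 1 by move=> Ix; rewrite ler_norml f'1.
have {}g'1 x : I x -> `|g' x| <= 1 by move=> Ix; rewrite ler_norml g'1.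
rewrite int01_cut//; have gi := integ_bounded mg' g'1.
apply: norm_int01_le; first by apply: measurable_funM => //; exact: measurable_K.
move=> x Ix; rewrite normrM mulr_ile1// ?f'1//.
rewrite (le_trans (norm_K_le_int bU Ix gi))// -[leRHS](@int01_cst R).
apply: le_int01 => //; first exact: integ_norm.
by apply: (@integ_bounded _ (fun=> 1) 1) => // z _; rewrite normr1.
Qed.

(* Test [|K f|^2 = <K f, K f>] against [K f], which is bounded by [1], after
   truncating [f] at height [M]; the tail has [L^1] norm at most [1 / M]. *)
Lemma kop_le_cutnorm (f : L2space R) (M : R) : 0 < M -> N f <= 1 ->
  N (kop bU f) ^+ 2 <= M * cutnorm U + M^-1.
Proof.
move=> M0 f1; pose g := kop bU f.
pose f0 x := Num.max (- M) (Num.min M (f x)).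
have f0M x : `|f0 x| <= M.
  by rewrite ler_norml /f0 le_max lexx/= ge_max ge_min lexx/= andbT; lra.
have mf0 : mfun f0.
  apply: measurable_maxr => //; apply: measurable_minr => //; exact: L2_mfun (L2funP f).
have L2f0 : L2 f0 by apply: (@L2_bounded _ _ M).
(* The left side is the excess of [|f x|] over [M]: it is 0 up to height [M], and above it is at
   most [|f x|], which is then at most [f x ^+ 2 / M]. *)
have tail x : `|f x - f0 x| <= M^-1 * f x ^+ 2.
  rewrite -(ler_pM2l M0) mulrA mulfV ?gt_eqF// mul1r /f0.
  have f2 : M * (2 * `|f x| - M) <= f x ^+ 2.
    rewrite -(real_normK (num_real (f x))); have := sqr_ge0 (`|f x| - M); nra.
  have [h1|h1] := lerP (f x) M; have [h2|h2] := lerP (- M) (f x).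
  - by rewrite subrr normr0 mulr0 sqr_ge0.
  - rewrite ler0_norm; last by lra.
    nra.
  - rewrite max_r; last by lra.
    rewrite ger0_norm; last by lra.
    nra.
  - by exfalso; lra.
have -> : N g ^+ 2 = ip (K U f) g by rewrite seminorm_sqr -ip_kop.
pose d x := f x - f0 x.
have L2d : L2 d := L2_sub (L2funP f) L2f0.
have Kf x : I x -> K U f x = K U f0 x + K U d x.
  move=> Ix; rewrite /K -int01D; last 2 first.
  - exact: kernel_mul_integ Ix (L2_integ L2f0).
  - exact: kernel_mul_integ Ix (L2_integ L2d).
  by apply: eq_int01 => y _; rewrite /d; ring.
have -> : ip (K U f) g = ip (K U f0) g + ip (K U d) g.
  rewrite /ip -int01D; last 2 first.
  - exact: L2_mul (L2_K bU L2f0) (L2funP g).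
  - exact: L2_mul (L2_K bU L2d) (L2funP g).
  by apply: eq_int01 => x Ix; rewrite Kf// mulrDl.
have g1 x : I x -> `|g x| <= 1 by move=> Ix; rewrite (le_trans (norm_kop_le _ Ix)).
have mg : mfun g := L2_mfun (L2funP g).
apply: lerD.
  (* Rescaling the truncated function to an admissible test function costs the factor [M]. *)
  pose h x := M^-1 * f0 x.
  have mh : mfun h by apply: measurable_funM.
  have h1 x : I x -> `|h x| <= 1.
    by move=> _; rewrite /h normrM gtr0_norm ?invr_gt0// mulrC ler_pdivrMr// mul1r.
  have -> : ip (K U f0) g = M * ip (K U h) g.
    have L2h : L2 h by apply: (@L2_bounded _ _ 1).
    rewrite /ip -int01Z; last exact: L2_mul (L2_K bU L2h) (L2funP g).
    apply: eq_int01 => x Ix; rewrite mulrA; congr (_ * _).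
    rewrite /K -int01Z; last exact: kernel_mul_integ Ix (L2_integ L2h).
    by apply: eq_int01 => y _; rewrite /h; field; rewrite gt_eqF.
  by rewrite ler_pM2l// (le_trans (ler_norm _))// ip_le_cutnorm.
have di := L2_integ L2d.
rewrite (le_trans (ler_norm _))//; apply: norm_int01_le.
  by apply: measurable_funM => //; exact: measurable_K.
move=> x Ix; rewrite normrM -[leRHS]mulr1 ler_pM// ?g1//.
rewrite (le_trans (norm_K_le_int bU Ix di))//.
have f2i : integ (fun y => f y ^+ 2) := (L2funP f).2.
apply: (@le_trans _ _ (int01 (fun y => M^-1 * f y ^+ 2))).
  by apply: le_int01; [exact: integ_norm|exact: integZ|move=> y _; exact: tail].
rewrite int01Z// -[leRHS]mulr1 ler_pM2l ?invr_gt0//.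
have -> : int01 (fun y => f y ^+ 2) = N f ^+ 2 by rewrite seminorm_sqr.
by rewrite expr_le1// seminorm_ge0.
Qed.

End OneKernel2.
End KernelOperator.

(** * Measure-preserving bijections and the cut distance *)

Section MeasurePreserving.
Context {R : realType}.
Local Notation mR := (measurableTypeR R).
Local Notation leb := (@lebesgue_measure R).
Local Notation I := (@I01 R).
Local Notation mfun f := (@measurable_fun _ _ mR R I f).
Implicit Types (f g phi psi : R -> R) (U V W : R -> R -> R).

(** [mpb] constrains a map only on the unit interval, whereas [graphon] asks for measurability on
    the whole plane; the extension by the identity is measurable on the line and pulls the interval
    back to itself. *)
Definition extend_id phi x := if x \in I then phi x else x.

Lemma extend_idE phi x : I x -> extend_id phi x = phi x.
Proof. by move=> Ix; rewrite /extend_id mem_set. Qed.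

Lemma extend_id_out phi x : ~ I x -> extend_id phi x = x.
Proof. by move=> Ix; rewrite /extend_id memNset. Qed.

Lemma measurable_extend_id phi : mfun phi -> @measurable_fun _ _ mR mR setT (extend_id phi).
Proof.
move=> mphi.
have -> : extend_id phi = (fun x => (phi \_ I) x + (id \_ (~` I)) x).
  apply/funext => x; have [Ix|Ix] := pselect (I x).
    by rewrite extend_idE// I01_patch// [X in _ + X]patchE memNset ?addr0// => /(_ Ix).
  by rewrite extend_id_out// I01_patch0// patchT ?inE// add0r.
have mI := @measurable_I01 R.
have m1 := (measurable_restrictT phi mI).1 mphi.
have mid : @measurable_fun _ _ mR R (~` I) id by exact: (@measurable_id _ mR).
have m2 := (measurable_restrictT id (measurableC mI)).1 mid.
exact: measurable_funD m1 m2.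
Qed.

Lemma eq_mpb phi phi' : (forall x, I x -> phi x = phi' x) -> mpb phi -> mpb phi'.
Proof.
move=> E [psi [phiI [psiI [psiK [phiK [mphi [mpsi [lphi lpsi]]]]]]]].
exists psi; split; first by move=> x Ix; rewrite -E//; exact: phiI.
split => //; split; first by move=> x Ix; rewrite -E//; exact: psiK.
split; first by move=> x Ix; rewrite -E//; [exact: phiK|exact: psiI].
split; first by apply: eq_measurable_fun mphi => x /set_mem; exact: E.
split => //; split => // B mB BI; rewrite -(lphi B mB BI); congr (leb _).
by apply/seteqP; split => x [Ix] /=; [rewrite -E|rewrite E].
Qed.

Lemma mpb_id : mpb (@id R).
Proof.
exists id; split => //; split => //; split => //; split => //.
split; first exact: measurable_id.
split; first exact: measurable_id.
by split => B _ BI; congr (leb _); apply/setIidr.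
Qed.

Lemma mpb_inverse phi : mpb phi -> exists psi,
  [/\ mpb psi, (forall x, I x -> psi (phi x) = x) & forall x, I x -> I (phi x)].
Proof.
move=> [psi [phiI [psiI [psiK [phiK [mphi [mpsi [lphi lpsi]]]]]]]].
exists psi; split => //; exists phi.
by do 8?split.
Qed.

Lemma mpb_maps phi x : mpb phi -> I x -> I (phi x).
Proof. by case=> psi [phiI _]; exact: phiI. Qed.

Lemma mpb_mfun phi : mpb phi -> mfun phi.
Proof. by case=> psi [_ [_ [_ [_ [mphi _]]]]]. Qed.

Lemma mpb_extend phi : mpb phi -> mpb (extend_id phi).
Proof. by apply: eq_mpb => x Ix; rewrite extend_idE. Qed.

Lemma comp_mpb_mfun phi f : mpb phi -> mfun f -> mfun (f \o phi).
Proof.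
move=> pphi mf; have mphi := measurable_extend_id (mpb_mfun pphi).
have mf' := (measurable_restrictT f (@measurable_I01 R)).1 mf.
have := measurable_funTS (measurableT_comp mf' mphi) (D := I).
apply: eq_measurable_fun => x /set_mem Ix.
by rewrite /= extend_idE// I01_patch//; exact: mpb_maps.
Qed.

(** On subsets of the unit interval, the pushforward of Lebesgue measure under the extended
    bijection is Lebesgue measure. *)
Lemma int01_mpb phi f (M : R) : mpb phi -> mfun f -> (forall x, I x -> `|f x| <= M) ->
  int01 (f \o phi) = int01 f.
Proof.
move=> pphi mf fM; have mI := @measurable_I01 R.
have mphi := measurable_extend_id (mpb_mfun pphi).
have mf' := (measurable_restrictT f mI).1 mf.
have preI : extend_id phi @^-1` I = I.
  apply/seteqP; split => x /=; have [Ix|Ix] := pselect (I x) => //.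
  - by rewrite extend_id_out.
  - by move=> _; rewrite extend_idE//; exact: mpb_maps.
have fphi : leb.-integrable I (EFin \o (f \o phi)).
  apply: (@integ_bounded _ _ M); first exact: comp_mpb_mfun.
  by move=> x Ix; apply/fM/mpb_maps.
have -> : int01 f =
    fine (\int[pushforward leb (extend_id phi : mR -> mR)]_(y in I) (EFin \o (f \_ I)) y)%E.
  congr fine; transitivity (\int[leb]_(y in I) (EFin \o (f \_ I)) y)%E.
    by apply: eq_integral => x /set_mem Ix; rewrite /= I01_patch.
  apply: eq_measure_integral => A mA AI; rewrite /= /pushforward.
  have [psi [_ [_ [_ [_ [_ [_ [lphi _]]]]]]]] := pphi.
  rewrite -[LHS](lphi A mA AI); congr (leb _); apply/esym/seteqP; split => x /=.
    have [Ix|Ix] := pselect (I x); first by rewrite extend_idE.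
    by rewrite extend_id_out// => /AI.
  by move=> [Ix Ax]; rewrite extend_idE.
rewrite (integral_pushforward mphi) ?preI//.
- congr fine; apply: eq_integral => x /set_mem Ix.
  by rewrite /= extend_idE// I01_patch//; exact: mpb_maps.
- exact/measurable_EFinP.
- apply: eq_integrable fphi => // x /set_mem Ix.
  by rewrite /= extend_idE// I01_patch//; exact: mpb_maps.
Qed.

Lemma graphon_sub_bounded U V : graphon U -> graphon V ->
  bounded_kernel (fun x y => U x y - V x y).
Proof.
move=> [mU [sU U01]] [mV [sV V01]]; split.
- exact: (@measurable_funB _ (mR * mR)%type R setT _ _ mU mV).
- by move=> x y Ix Iy; rewrite sU// sV.
- move=> x y Ix Iy; have /andP[u0 u1] := U01 x y Ix Iy.
  by have /andP[v0 v1] := V01 x y Ix Iy; rewrite ler_norml; apply/andP; split; lra.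
Qed.

Lemma graphon_bounded U : graphon U -> bounded_kernel U.
Proof.
move=> [mU [sU U01]]; split => // x y Ix Iy.
by have /andP[u0 u1] := U01 x y Ix Iy; rewrite ger0_norm.
Qed.

Lemma measurable_compose_extend U phi : mfun phi ->
  @measurable_fun _ _ (mR * mR)%type R setT (fun p => U p.1 p.2) ->
  @measurable_fun _ _ (mR * mR)%type R setT (fun p => compose U (extend_id phi) p.1 p.2).
Proof.
move=> mphi mU; have mphi' := measurable_extend_id mphi.
apply: (measurableT_comp mU (g := fun p : mR * mR => (extend_id phi p.1, extend_id phi p.2))).
apply: measurable_fun_pair.
- exact: (measurableT_comp mphi' (@measurable_fst _ _ mR mR)).
- exact: (measurableT_comp mphi' (@measurable_snd _ _ mR mR)).
Qed.

Lemma bounded_kernel_compose U phi : mpb phi -> bounded_kernel U ->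
  bounded_kernel (compose U (extend_id phi)).
Proof.
move=> pphi [mU sU U1].
have maps x : I x -> I (extend_id phi x) by move=> Ix; exact: mpb_maps (mpb_extend pphi) Ix.
split; first exact: measurable_compose_extend (mpb_mfun pphi) mU.
- by move=> x y Ix Iy; apply: sU; exact: maps.
- by move=> x y Ix Iy; apply: U1; exact: maps.
Qed.

Lemma graphon_compose U phi : mpb phi -> graphon U -> graphon (compose U (extend_id phi)).
Proof.
move=> pphi [mU [sU U01]].
have maps x : I x -> I (extend_id phi x) by move=> Ix; exact: mpb_maps (mpb_extend pphi) Ix.
split; first exact: measurable_compose_extend (mpb_mfun pphi) mU.
by split => x y Ix Iy; [apply: sU|apply: U01]; exact: maps.
Qed.

Lemma eq_cutnorm U V : (forall x y, I x -> I y -> U x y = V x y) -> cutnorm U = cutnorm V.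
Proof.
move=> UV; have E f g : int01 (fun x => int01 (fun y => f x * U x y * g y)) =
    int01 (fun x => int01 (fun y => f x * V x y * g y)).
  by apply: eq_int01 => x Ix; apply: eq_int01 => y Iy; rewrite UV.
apply: (f_equal sup); apply/seteqP; split => _ [f [g [mf [mg [f1 [g1 ->]]]]]].
- exists f, g; rewrite E; exact: (conj mf (conj mg (conj f1 (conj g1 erefl)))).
- exists f, g; rewrite -E; exact: (conj mf (conj mg (conj f1 (conj g1 erefl)))).
Qed.

Lemma cutnorm_nonempty U : [set r | exists f g : R -> R,
   measurable_fun I f /\ measurable_fun I g /\
   (forall x, I x -> -1 <= f x <= 1) /\ (forall x, I x -> -1 <= g x <= 1) /\
   r = `| int01 (fun x => int01 (fun y => f x * U x y * g y)) | ] !=set0.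
Proof.
eexists; exists (fun=> 0), (fun=> 0); split; first exact: measurable_cst.
split; first exact: measurable_cst.
split; last split => //.
all: by move=> x _; apply/andP; split; lra.
Qed.

Lemma cutnorm_ge0 U : 0 <= cutnorm U.
Proof.
rewrite /cutnorm; set E := [set _ | _].
(* A set without a supremum has [sup] equal to 0, so the bound holds for every [U]. *)
have [supE|/sup_out -> //] := pselect (has_sup E).
have [r Er] := supE.1; apply: le_trans (ub_le_sup supE.2 Er).
by case: Er => f [g [_ [_ [_ [_ ->]]]]].
Qed.

Lemma cutnorm0 U : (forall x y, I x -> I y -> U x y = 0) -> cutnorm U = 0.
Proof.
move=> U0; apply/eqP; rewrite eq_le cutnorm_ge0 andbT.
apply: ge_sup; first exact: cutnorm_nonempty.
move=> _ [f [g [_ [_ [_ [_ ->]]]]]].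
rewrite (@eq_int01 _ _ (fun=> 0)) ?int01_cst ?normr0// => x Ix.
rewrite -[RHS](@int01_cst R); apply: eq_int01 => y Iy.
by rewrite U0// mulr0 mul0r.
Qed.

(** Test functions for [U], precomposed with [phi], are test functions for the composed kernel and
    give the same value by a change of variable in each coordinate. *)
Lemma cutnorm_compose_le U phi : mpb phi -> bounded_kernel U ->
  cutnorm U <= cutnorm (compose U phi).
Proof.
move=> pphi bU; have bUp := bounded_kernel_compose pphi bU.
rewrite -(@eq_cutnorm (compose U (extend_id phi)) (compose U phi)); last first.
  by move=> x y Ix Iy; rewrite /compose !extend_idE//.
apply: ge_sup; first exact: cutnorm_nonempty.
move=> _ [f [g [mf [mg [f1 [g1 ->]]]]]].
have {}f1 x : I x -> `|f x| <= 1 by move=> Ix; rewrite ler_norml f1.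
have {}g1 x : I x -> `|g x| <= 1 by move=> Ix; rewrite ler_norml g1.
have [_ _ U1] := bU; have gi := integ_bounded mg g1.
have Kg1 x : I x -> `|K U g x| <= 1.
  move=> Ix; rewrite (le_trans (norm_K_le_int bU Ix gi))// -[leRHS](@int01_cst R).
  apply: le_int01 => //; first exact: integ_norm.
  by apply: (@integ_bounded _ (fun=> 1) 1) => // z _; rewrite normr1.
rewrite (int01_cut bU)//.
have -> : ip (K U g) f = ip (K (compose U (extend_id phi)) (g \o phi)) (f \o phi).
  transitivity (int01 ((fun x => K U g x * f x) \o phi)).
    apply/esym/(@int01_mpb _ _ 1) => //.
      by apply: measurable_funM => //; exact: measurable_K.
    by move=> x Ix; rewrite normrM mulr_ile1// ?Kg1// f1.
  apply: eq_int01 => x Ix /=; congr (_ * _).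
  have Ipx := mpb_maps pphi Ix.
  rewrite /K -(@int01_mpb phi (fun y => U (phi x) y * g y) 1)//.
  - by apply: eq_int01 => y Iy; rewrite /compose /= !extend_idE.
  - by apply: measurable_funM => //; exact: kernel_section.
  - by move=> y Iy; rewrite normrM mulr_ile1// ?U1// g1.
apply: ip_le_cutnorm => //; try exact: comp_mpb_mfun.
- by move=> x Ix; apply/f1/mpb_maps.
- by move=> x Ix; apply/g1/mpb_maps.
Qed.

Lemma delta_set_lbound U V : has_lbound [set r | exists phi, mpb phi /\
   r = cutnorm (fun x y => U x y - compose V phi x y)].
Proof. by exists 0 => _ [phi [_ ->]]; exact: cutnorm_ge0. Qed.

Lemma delta_ge0 U V : 0 <= delta U V.
Proof.
apply: lb_le_inf; first by eexists; exists id; split => //; exact: mpb_id.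
by move=> _ [phi [_ ->]]; exact: cutnorm_ge0.
Qed.

Lemma delta_self U : delta U U = 0.
Proof.
apply/eqP; rewrite eq_le delta_ge0 andbT; apply: ge_inf; first exact: delta_set_lbound.
exists id; split; first exact: mpb_id.
by rewrite cutnorm0// => x y _ _; rewrite /compose subrr.
Qed.

(* The aligning bijection is moved from [V] to [U] by inverting it. *)
Lemma delta_align U V (e : R) : graphon U -> graphon V -> 0 < e ->
  exists psi, [/\ mpb psi, graphon (compose U psi) &
    cutnorm (fun x y => compose U psi x y - V x y) < delta U V + e].
Proof.
move=> gU gV e0.
have infD : has_inf [set r | exists phi, mpb phi /\
   r = cutnorm (fun x y => U x y - compose V phi x y)].
  split; last exact: delta_set_lbound.
  by eexists; exists id; split => //; exact: mpb_id.
have [_ [phi [pphi ->]] lt_phi] := inf_adherent e0 infD.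
have [psi [ppsi psiK phiI]] := mpb_inverse pphi.
exists (extend_id psi).
have gUpsi := graphon_compose ppsi gU.
split; [exact: mpb_extend|exact: gUpsi|].
apply: le_lt_trans lt_phi.
apply: le_trans (cutnorm_compose_le pphi (graphon_sub_bounded gUpsi gV)) _.
rewrite le_eqVlt; apply/orP; left; apply/eqP; apply: eq_cutnorm => x y Ix Iy.
by rewrite /compose !extend_idE ?psiK//; exact: phiI.
Qed.

End MeasurePreserving.

(** Ensures that the projection onto an eigenspace, which [exists_projection] provides only as an
    adherent vector, is itself an eigenvector. *)
Lemma eigenvector_closed (R : realType) (H : lmodType R) (ip : semi_inner H)
    (T : {linear H -> H}) l x : compact_selfadjoint ip T ->
  adherent ip (eigenvector ip T l) x -> eigenvector ip T l x.
Proof.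
move=> cT xl; apply/eqP; rewrite -/(seminorm _ _) eq_le seminorm_ge0 andbT.
apply: (@le_eps0 _ _ (1 + `|l|)); first by rewrite addr_ge0.
move=> e /xl[v lv xv].
have -> : T x - l *: x = (T v - l *: v) + (T (x - v) - l *: (x - v)).
  rewrite -[in LHS](subrK v x); move: (x - v) => y.
  by rewrite raddfD scalerDr opprD addrACA addrC.
rewrite (le_trans (seminormD _ _ _))// lv add0r.
rewrite (le_trans (seminormD _ _ _))// seminormN seminormZ.
rewrite mulrDr mulr1 lerD//.
  by rewrite (le_trans (op_contraction cT _))// ltW.
by rewrite mulrC ler_wpM2r// ltW.
Qed.

(** * Spectral measures of graphons and vague convergence *)

Section SpectralMeasure.
Context {R : realType}.
Local Notation I := (@I01 R).
Local Notation N := (seminorm (L2ip R)).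
Implicit Types (f g : R -> R) (U V W : R -> R -> R).

Lemma L2fun_sum (s : seq R) (p : R -> L2space R) x :
  (\sum_(l <- s) p l) x = \sum_(l <- s) p l x.
Proof.
elim: s => [|l s IH]; first by rewrite !big_nil.
by rewrite !big_cons L2funD IH.
Qed.

Lemma eigsp_eigenvector W (bW : bounded_kernel W) l (h : L2space R) :
  eigsp W l h <-> eigenvector (L2ip R) (kop bW) l h.
Proof.
have -> : eigenvector (L2ip R) (kop bW) l h = (norm2 (fun x => K W h x - l * h x) = 0).
  rewrite /eigenvector /seminorm /norm2; congr (Num.sqrt _ = 0).
  by apply: eq_ip => x Ix; rewrite L2funB L2funZ kopE.
by split => [[]//|h0]; split => //; exact: L2funP.
Qed.

(** The approximation in [PW] is conditional on a family of projections onto the eigenspaces, so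
    such a family [p] has to be produced. Its partial sums lie in the eigenspan, which makes [g]
    adherent. For orthogonality to an eigenvector, its eigenvalue is added to the finite set of
    indices. *)
Lemma PW_spectral_proj W (bW : bounded_kernel W) (A : set R) f g (f2 : L2 f) (g2 : L2 g) :
  PW W A f g -> spectral_proj (L2ip R) (kop bW) A (toL2 f2) (toL2 g2).
Proof.
move=> [_ gP]; have cW := kop_compact_selfadjoint bW.
set F := toL2 f2; set G := toL2 g2.
pose eig := eigenvector (L2ip R) (kop bW).
have exp l : exists q, eig l q /\ forall v, eig l v -> L2ip R (F - q) v = 0.
  have [q lq qP] := exists_projection (@L2_complete R) F (eig_subspace (L2ip R) (kop bW) l).
  by exists q; split => //; exact: eigenvector_closed lq.
have [p pP] := choice exp.
have approx e : 0 < e -> exists S0 : seq R, (forall l, l \in S0 -> A l) /\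
    forall S, uniq S -> (forall l, l \in S -> A l) -> {subset S0 <= S} ->
      N (G - \sum_(l <- S) p l) < e.
  move=> e0; have [S0 [S0A S0P]] := gP e e0; exists S0; split => // S uS SA S0S.
  have := S0P S uS SA S0S (fun l => p l).
  have -> : norm2 (fun x => g x - \sum_(l <- S) p l x) = N (G - \sum_(l <- S) p l).
    by rewrite /norm2 /seminorm; congr Num.sqrt; apply: eq_ip => x _; rewrite L2funB L2fun_sum.
  apply => l lS; split; first by apply/(eigsp_eigenvector bW); exact: (pP l).1.
  move=> h [h2 h0]; have : eig l (toL2 h2) by apply/(eigsp_eigenvector bW).
  exact: (pP l).2.
split.
  move=> e /approx[S0 [S0A S0P]].
  have uA l : l \in undup S0 -> A l by rewrite mem_undup; exact: S0A.
  exists (\sum_(l <- undup S0) p l).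
    exists (undup S0), p; split => //; first exact: undup_uniq.
    by move=> l _; exact: (pP l).1.
  apply: S0P => //; first exact: undup_uniq.
  by move=> l; rewrite mem_undup.
move=> l v Al lv; apply/eqP; rewrite -normr_le0.
apply: (@le_eps0 _ _ (N v)); first exact: seminorm_ge0.
move=> e /approx[S0 [S0A S0P]].
(* With [l] among the indices, [F - q] is exactly orthogonal to [v], and [G - q] is still small. *)
pose S := undup (l :: S0); have lS : l \in S by rewrite mem_undup mem_head.
have uS : uniq S := undup_uniq _.
have SA m : m \in S -> A m by rewrite mem_undup inE => /orP[/eqP ->|/S0A].
have S0S : {subset S0 <= S} by move=> m mS0; rewrite mem_undup inE mS0 orbT.
have {}S0P := S0P S uS SA S0S.
set q := \sum_(m <- S) p m in S0P.
have Fq : L2ip R (F - q) v = 0.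
  have -> : F - q = (F - p l) - \sum_(m <- rem l S) p m.
    by rewrite /q (big_rem l)//= opprD addrA.
  rewrite innerBl ((pP l).2 v lv) sub0r inner_suml big1_seq ?oppr0// => m /andP[_].
  rewrite mem_rem_uniq// inE => /andP[ml _].
  exact: (eig_orth cW ml (pP m).1 lv).
have -> : F - G = (F - q) - (G - q) by rewrite opprB addrA subrK.
rewrite innerBl Fq sub0r normrN (le_trans (cauchy_schwarz _ _ _))//.
by rewrite ler_wpM2r ?seminorm_ge0// ltW.
Qed.

Lemma kop_sub U V (bU : bounded_kernel U) (bV : bounded_kernel V)
    (bD : bounded_kernel (fun x y => U x y - V x y)) (f : L2space R) :
  kop bU f - kop bV f = kop bD f.
Proof.
apply: val_inj; apply/funext => x /=.
rewrite -[LHS]/(kop_fun U f x - kop_fun V f x) /kop_fun.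
have [Ix|Ix] := pselect (I x); last by rewrite !(I01_patch0 _ Ix) subr0.
rewrite !I01_patch// /K -int01B; last 2 first.
- exact: kernel_mul_integ bU _ _ Ix (L2_integ (L2funP _)).
- exact: kernel_mul_integ bV _ _ Ix (L2_integ (L2funP _)).
by apply: eq_int01 => y _; rewrite mulrBl.
Qed.

Lemma kop_small U (bU : bounded_kernel U) (eta : R) : 0 < eta ->
  cutnorm U <= eta ^+ 4 / 4 -> forall f : L2space R, N (kop bU f) <= eta * N f.
Proof.
move=> eta0 cU.
have unit_ball (f : L2space R) : N f <= 1 -> N (kop bU f) <= eta.
  (* The height [M = 2 / eta ^+ 2] balances the two terms: each of [M * (eta ^+ 4 / 4)] and [M^-1]
     equals [eta ^+ 2 / 2]. *)
  move=> f1; have M0 : 0 < 2 / eta ^+ 2 by rewrite divr_gt0 ?exprn_gt0.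
  have := kop_le_cutnorm bU M0 f1 => h.
  rewrite -ler_sqr ?nnegrE ?seminorm_ge0 ?(ltW eta0)//; apply: le_trans h _.
  apply: (@le_trans _ _ (2 / eta ^+ 2 * (eta ^+ 4 / 4) + (2 / eta ^+ 2)^-1)).
    by rewrite lerD2r ler_pM2l.
  rewrite le_eqVlt; apply/orP; left; apply/eqP; field.
  by rewrite gt_eqF.
move=> f; have [f0|f0] := eqVneq (N f) 0.
  rewrite f0 mulr0 -f0; exact: op_contraction (kop_compact_selfadjoint bU) f.
have fp : 0 < N f by rewrite lt_neqAle eq_sym f0 seminorm_ge0.
have := unit_ball ((N f)^-1 *: f).
rewrite linearZ /= !seminormZ ger0_norm ?invr_ge0 ?seminorm_ge0// mulVf// lexx => /(_ isT).
by rewrite mulrC ler_pdivrMr.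
Qed.

Theorem delta_cvg_vague_conv (Wn : nat -> R -> R -> R) W :
  (forall n, graphon (Wn n)) -> graphon W ->
  (fun n => delta (Wn n) W) @ \oo --> (0 : R) ->
  vague_conv (fun m n : nat => (m <= n)%N) Wn W.
Proof.
move=> gWn gW Wn_W; have bW := graphon_bounded gW.
have cW := kop_compact_selfadjoint bW.
have half_gt0 n : 0 < 2^-1 ^+ n :> R by rewrite exprn_gt0 ?invr_gt0.
(* The infimum in [delta] need not be attained; an alignment within [2^-1 ^+ n] of it still has cut
   norm tending to 0. *)
have [psi psiP] := choice (fun n => delta_align (gWn n) gW (half_gt0 n)).
exists Wn, psi, W, [set d | d != 0 /\ non_eigenvalue (L2ip R) (kop bW) d].
split; first by move=> n; split => //; exact: delta_self.
split; first by move=> n; have [] := psiP n.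
split => //; split; first exact: delta_self.
split.
  move=> x y xy; have [d [d0 nd xdy]] := exists_non_eigenvalue cW (@L2_complete R) xy.
  by exists d.
move=> a b [a0 na] [b0 nb] eps eps0.
have [eta eta0 etaP] := spectral_proj_continuous (@L2_complete R) cW a0 b0 na nb eps0.
have eta4 : 0 < eta ^+ 4 / 4 by rewrite divr_gt0 ?exprn_gt0.
have bound0 : (fun n => delta (Wn n) W + 2^-1 ^+ n) @ \oo --> (0 : R).
  by rewrite -[X in _ --> X]addr0; apply: cvgD => //; exact: cvg_half_exp.
have [n0 n0P] := cvg0_lt bound0 eta4.
exists n0 => n /n0P n_small f g1 g2 f2 f1 P1 P2.
have [_ gC cut_lt] := psiP n.
have bC := graphon_bounded gC.
have bD := graphon_sub_bounded gC gW.
have near_W h : N (kop bC h - kop bW h) <= eta * N h.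
  rewrite (kop_sub bC bW bD); apply: kop_small => //.
  exact: ltW (lt_trans cut_lt (le_lt_trans (ler_norm _) n_small)).
have L2g1 := P1.1; have L2g2 := P2.1.
exact: (etaP _ (kop_compact_selfadjoint bC) near_W (toL2 f2) (toL2 L2g1) (toL2 L2g2) f1
  (PW_spectral_proj bC f2 L2g1 P1) (PW_spectral_proj bW f2 L2g2 P2)).
Qed.

End SpectralMeasure.

Theorem theorem3p2 (R : realType) :
  (* continuity of hat F : (hat W_0, delta_Box) -> (hat M, vague topology) *)
  (forall U : (R -> R -> R) -> Prop,
     saturated U -> vague_open U ->
     forall W, graphon W -> U W ->
       exists eps : R, 0 < eps /\
         forall V, graphon V -> delta V W < eps -> U V) /\
  (* in particular: delta_Box(W_n, W) -> 0 implies vague convergence *)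
  (forall (Wn : nat -> R -> R -> R) (W : R -> R -> R),
     (forall n, graphon (Wn n)) -> graphon W ->
     (fun n => delta (Wn n) W) @ \oo --> (0 : R) ->
     vague_conv (fun m n : nat => (m <= n)%N) Wn W).
Proof.
split; last exact: delta_cvg_vague_conv.
(* If no ball around [W] lies in [U], points outside [U] at distance less than [2^-1 ^+ n] form a
   sequence, hence a net, converging vaguely to [W]; openness puts it eventually in [U]. *)
move=> U _ openU W gW UW; apply: contrapT => nU.
have exV n : exists V, [/\ graphon V, delta V W < 2^-1 ^+ n & ~ U V].
  apply: contrapT => nV; apply: nU; exists (2^-1 ^+ n).
  split; first by rewrite exprn_gt0 ?invr_gt0.
  by move=> V gV VW; apply: contrapT => nUV; apply: nV; exists V.
have [V VP] := choice exV.
have gV n : graphon (V n) by have [] := VP n.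
have V_W : (fun n => delta (V n) W) @ \oo --> (0 : R).
  apply: (@cvg0_le _ 1) (@cvg_half_exp R) => // n; have [_ VWn _] := VP n.
  rewrite mul1r ger0_norm ?delta_ge0// ger0_norm ?exprn_ge0 ?invr_ge0//.
  exact: ltW.
have dir : directed (fun m n : nat => (m <= n)%N).
  split; first by exists 0%N.
  split => //; split; first by move=> i j k; exact: leq_trans.
  by move=> i j; exists (maxn i j); rewrite leq_maxl leq_maxr.
have [n0 n0P] := openU _ _ _ _ dir gV gW UW (delta_cvg_vague_conv gV gW V_W).
by have [_ _] := VP n0; apply; exact: n0P.
Qed.
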